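(* Let $\Omega$ be a bounded domain in $\mathbb{R}^n$, $p>1$, and let $f$ satisfy the standing assumptions, with $k=(f')^{-1}$. Let $\nu\in\mathcal{P}(\Omega)$ be of the form $\nu=\nu^s+v\cdot\mathcal{L}^n$ with $\nu^s\perp\mathcal{L}^n$, $v\in L^\infty(\Omega)$ and $v>0$ a.e. in $\Omega$. Let $\mu=u\cdot\mathcal{L}^n$ minimize $\mathfrak{F}^p_\nu$ over $\mathcal{P}(\Omega)$, and let $\psi$ be a Kantorovich potential for the transport between $\mu$ and $\nu$ with cost $|x-y|^p$ (under these hypotheses it is unique up to additive constants). Then there exists a constant $l\in\mathbb{R}$ such that $l-\psi\geq 0$ a.e. and $$u=k(l-\psi)\quad\text{a.e. in }\Omega.$$
   Context: A bounded domain is a bounded set $\Omega\subset\mathbb{R}^n$ which is the closure of a nonempty connected open set and whose boundary is Lebesgue-negligible. $\mathcal{P}(\Omega)$ is the set of Borel probability measures on $\Omega$. Standing assumptions on $f$: $f:[0,+\infty)\to[0,+\infty)$ is strictly convex and $C^1$, $f(0)=0$, $f'(0)=0$, and $\lim_{t\to+\infty}f(t)/t=+\infty$; $k=(f')^{-1}:[0,+\infty)\to[0,+\infty)$ is then continuous and strictly increasing. $T_p(\mu,\nu)=\inf_\gamma\int|x-y|^p\,d\gamma$ over transport plans $\gamma$ (probability measures on $\Omega\times\Omega$ with marginals $\mu,\nu$). $F(\mu)=\int_\Omega f(u)\,dx$ if $\mu=u\cdot\mathcal{L}^n$, $+\infty$ otherwise. $\mathfrak{F}^p_\nu(\mu)=T_p(\mu,\nu)+F(\mu)$.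 For $c(x,y)=|x-y|^p$ and $\chi:\Omega\to\mathbb{R}$, the $c$-transform is $\chi^c(y)=\inf_{x\in\Omega}\big(c(x,y)-\chi(x)\big)$; $\chi$ is $c$-concave if $\chi=\phi^c$ for some $\phi$. A Kantorovich potential between $\mu$ and $\nu$ is a $c$-concave function $\psi$ maximizing $\int\varphi\,d\mu+\int\varphi^c\,d\nu$ among $c$-concave $\varphi$; the maximum equals $T_p(\mu,\nu)$. *)

(* Defs.v *)
From HB Require Import structures.
From mathcomp Require Import all_boot all_order all_algebra.
From mathcomp Require Import all_classical all_reals all_analysis.
Import Order.TTheory GRing.Theory Num.Theory.
Import numFieldNormedType.Exports.
Local Open Scope ring_scope.
Local Open Scope classical_set_scope.

(* Points of R^n are represented as n-tuples of reals; the measurable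
   structure on [n.-tuple R] is the product (= Borel) sigma-algebra. *)

Definition edist {R : realType} {n : nat} (x y : n.-tuple R) : R :=
  Num.sqrt (\sum_(i < n) (tnth x i - tnth y i) ^+ 2).

(* identification of n-tuples with row vectors, used to transport the
   (standard) topology of R^n *)
Definition rv {R : realType} {n : nat} (x : n.-tuple R) : 'rV[R]_n :=
  \row_(i < n) tnth x i.

(* [leb] is the Lebesgue measure on (the Borel sets of) R^n:
   it gives to every closed box its volume (this determines it uniquely). *)
Definition is_lebesgue {R : realType} {n : nat}
  (leb : {measure set (n.-tuple R) -> \bar R}) : Prop :=
  forall a b : n.-tuple R, (forall i, tnth a i <= tnth b i) ->
    leb [set x | forall i, tnth a i <= tnth x i <= tnth b i] =
    (\prod_(i < n) (tnth b i - tnth a i))%:E.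

Definition bounded_domain {R : realType} {n : nat}
  (leb : {measure set (n.-tuple R) -> \bar R}) (Om : set (n.-tuple R)) : Prop :=
  bounded_set (rv @` Om) /\
  (exists O : set 'rV[R]_n,
      open O /\ connected O /\ O !=set0 /\ rv @` Om = closure O) /\
  leb.-negligible (rv @^-1` (closure (rv @` Om) `\` interior (rv @` Om))).

Definition in_P {R : realType} {n : nat} (Om : set (n.-tuple R))
  (mu : probability (n.-tuple R) R) : Prop := mu Om = 1%E.

Definition is_density {R : realType} {n : nat}
  (leb : {measure set (n.-tuple R) -> \bar R}) (Om : set (n.-tuple R))
  (mu : {measure set (n.-tuple R) -> \bar R}) (u : n.-tuple R -> R) : Prop :=
  measurable_fun Om u /\ (forall x, Om x -> 0 <= u x) /\
  forall A, measurable A ->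
    mu A = (\int[leb]_(x in A `&` Om) (u x)%:E)%E.

Definition transport_plan {R : realType} {n : nat} (Om : set (n.-tuple R))
  (mu nu : probability (n.-tuple R) R)
  (g : probability (n.-tuple R * n.-tuple R)%type R) : Prop :=
  g (Om `*` Om) = 1%E /\
  forall A, measurable A -> g (A `*` setT) = mu A /\ g (setT `*` A) = nu A.

Definition Tp {R : realType} {n : nat} (p : R) (Om : set (n.-tuple R))
  (mu nu : probability (n.-tuple R) R) : \bar R :=
  ereal_inf [set (\int[g]_z ((edist z.1 z.2) `^ p)%:E)%E
            | g in transport_plan Om mu nu].

(* F(mu) = \int f(u) dx if mu = u . L^n, +oo otherwise
   (the infimum over the empty set of densities is +oo; all densities
   agree a.e., hence give the same value) *)
Definition Fent {R : realType} {n : nat} (f : R -> R)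
  (leb : {measure set (n.-tuple R) -> \bar R}) (Om : set (n.-tuple R))
  (mu : probability (n.-tuple R) R) : \bar R :=
  ereal_inf [set (\int[leb]_(x in Om) (f (u x))%:E)%E
            | u in is_density leb Om mu].

Definition Ffun {R : realType} {n : nat} (p : R) (f : R -> R)
  (leb : {measure set (n.-tuple R) -> \bar R}) (Om : set (n.-tuple R))
  (nu mu : probability (n.-tuple R) R) : \bar R :=
  (Tp p Om mu nu + Fent f leb Om mu)%E.

Definition ctrans {R : realType} {n : nat} (p : R) (Om : set (n.-tuple R))
  (chi : n.-tuple R -> R) (y : n.-tuple R) : \bar R :=
  ereal_inf [set ((edist x y) `^ p - chi x)%:E | x in Om].

Definition c_concave {R : realType} {n : nat} (p : R) (Om : set (n.-tuple R))
  (chi : n.-tuple R -> R) : Prop :=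
  exists phi : n.-tuple R -> R,
    forall y, Om y -> (chi y)%:E = ctrans p Om phi y.

Definition kdual {R : realType} {n : nat} (p : R) (Om : set (n.-tuple R))
  (mu nu : probability (n.-tuple R) R) (phi : n.-tuple R -> R) : \bar R :=
  (\int[mu]_(x in Om) (phi x)%:E + \int[nu]_(y in Om) ctrans p Om phi y)%E.

Definition kantorovich_potential {R : realType} {n : nat} (p : R)
  (Om : set (n.-tuple R)) (mu nu : probability (n.-tuple R) R)
  (psi : n.-tuple R -> R) : Prop :=
  c_concave p Om psi /\
  forall phi, c_concave p Om phi -> (kdual p Om mu nu phi <= kdual p Om mu nu psi)%E.

(* Main.v *)
(* Write [w = f'(u)]. The transport cost is convex in its first marginal, so minimality of [mu]
   gives [T(mu, nu) + \int w dmu <= T(rho, nu) + \int w drho] for every bounded density [rho]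
   supported where [w] is bounded. Coupling [nu] with points [x] that almost minimize
   [|x - y|^p + w x] produces such competitors, whence [T(mu, nu) + \int w dmu <= \int g dnu],
   where [g y] is the essential infimum of [|x - y|^p + w x] over [x]. Then [phi = g^c] maximizes
   the dual problem and [w + phi], nonnegative a.e., vanishes [mu]-a.e.; where [u = 0] one has
   [0 = - w <= phi <= 0]. So [f'(u) = - phi] a.e.

   Potentials are unique up to a constant. The c-transform of the midpoint of two maximizers
   [phi], [psi] is the mean of [phi^c] and [psi^c], [nu]-a.e. and then everywhere by continuity,
   because [nu] charges every ball centred in the domain. Hence [phi^c] and [psi^c] have a common
   approximate c-supergradient at every point. As second differences of [|.|^p], [p > 1], are
   [o(|h|)], adding up increments along a segment shows that [phi^c - psi^c] is locally constant. *)

Require Import Defs.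
From HB Require Import structures.
From mathcomp Require Import all_boot all_order all_algebra.
From mathcomp Require Import ring lra.
From mathcomp Require Import all_classical all_reals all_analysis.
From mathcomp Require Import measurable_realfun ess_sup_inf.
Import Order.TTheory GRing.Theory Num.Theory.
Import numFieldNormedType.Exports.
Set Implicit Arguments.
Unset Strict Implicit.
Unset Printing Implicit Defensive.
Local Open Scope ring_scope.
Local Open Scope classical_set_scope.

(** * Powers of the Euclidean norm *)

Lemma compact_uniform_continuity {R : realType} {X Y : pseudoMetricType R}
    (K : set X) (f : X -> Y) (e : R) :
  compact K -> continuous f -> 0 < e ->
  exists2 d : R, 0 < d & forall x y, K x -> ball x d y -> ball (f x) e (f y).
Proof.
move=> /compact_near_coveringP cK cf e0.
have near_K : \forall d \near 0^'+, K `<=` [set x | forall y, ball x d y -> ball (f x) e (f y)].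
  apply: cK => x _; have e2 : 0 < e / 2 by rewrite divr_gt0.
  have /cf/nbhs_ballP[r /= r0 fr] := nbhsx_ballx (f x) _ e2.
  have r2 : 0 < r / 2 by rewrite divr_gt0.
  near=> x' d => y /= x'y.
  have xx' : ball x (r / 2) x' by near: x'; exact: nbhsx_ballx.
  have x'y2 : ball x' (r / 2) y.
    by apply: le_ball x'y; apply: ltW; near: d; exact: nbhs_right_lt.
  rewrite (splitr e); apply: (@ball_triangle _ _ (f x)).
    by apply: ball_sym; apply: fr; apply: le_ball xx'; rewrite ler_pdivrMr// ler_pMr// ler1n.
  by apply: fr; rewrite (splitr r); exact: ball_triangle x'y2.
have [d [d0 dK]] : exists d : R, 0 < d /\
    K `<=` [set x | forall y, ball x d y -> ball (f x) e (f y)].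
  by apply: (@filter_ex _ 0^'+); near=> d; split; [|near: d].
by exists d => // x y /dK; exact.
Unshelve. all: by end_near. Qed.

Lemma convex_above_tangent {R : realType} (f : R -> R) (s t l : R) :
  is_derive s (1 : R) f l ->
  (forall r, 0 < r < 1 -> f (r * t + (1 - r) * s) <= r * f t + (1 - r) * f s) ->
  f s + l * (t - s) <= f t.
Proof.
move=> fl conv; pose g (r : R) := r * (t - s) + s.
have g0 : g 0 = s by rewrite /g mul0r add0r.
have gl : is_derive (0 : R) (1 : R) (f \o g) (l * (t - s)).
  apply: is_derive1_comp; first by rewrite g0.
  by rewrite /g; apply: is_derive_eq; rewrite scaler0 add0r addr0 [LHS]mulr1.
have [dg gl_lim] := gl; rewrite -lerBrDl.
apply: (@cvgr_to_le _ (0^'+) _ _ (fun r => r^-1 *: (f (g r) - f s))).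
  apply: cvg_dnbhs_at_right; rewrite -gl_lim -g0.
  rewrite (_ : (fun r => _) = (fun h => h^-1 *: ((f \o g \o shift 0) (h *: (1 : R)) - (f \o g) 0))).
    exact: dg.
  by apply/funext => h; rewrite /= [h *: _]mulr1 addr0.
near=> r; have r0 : 0 < r by near: r; exact: nbhs_right_gt.
have r1 : r < 1 by near: r; exact: nbhs_right_lt.
rewrite [_ *: _]mulrC ler_pdivrMr// lerBlDr.
have -> : g r = r * t + (1 - r) * s by rewrite /g; ring.
by apply: le_trans (conv r _) _; [rewrite r0|lra].
Unshelve. all: by end_near. Qed.

Section PowerFunctions.
Context {R : realType}.
Implicit Types p q s t : R.

Lemma norm_powR_continuous q : 0 < q -> continuous (fun t : R => `|t| `^ q).
Proof.
move=> q0 t; have [->|t0] := eqVneq t 0; last first.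
  apply: (@continuous_comp _ _ _ (fun t : R => `|t|) (@powR R ^~ q)); first exact: norm_continuous.
  apply/differentiable_continuous/derivable1_diffP/derivable_powR.
  by rewrite in_itv/= andbT normr_gt0.
rewrite /continuous_at normr0 powR0 ?gt_eqF//; apply/cvgr0Pnorm_le => e e0.
exists (e `^ q^-1); first by rewrite /= powR_gt0.
move=> x /=; rewrite sub0r normrN => xe; rewrite ger0_norm ?powR_ge0//.
rewrite -[e]powRr1 ?(ltW e0)// -(mulVf (lt0r_neq0 q0)) powRrM.
by rewrite ge0_ler_powR ?nnegrE ?powR_ge0// ltW.
Qed.

Lemma powR_above_tangent p s t : 1 <= p -> 0 < s -> 0 <= t ->
  s `^ p + p * s `^ (p - 1) * (t - s) <= t `^ p.
Proof.
move=> p1 s0 t0; apply: (convex_above_tangent (is_derive1_powR p s0)) => r /andP[r0 r1].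
have r01 : 0 <= r <= 1 by rewrite !ltW.
have := @convex_powR R p p1 (Itv01 (ltW r0) (ltW r1)) t s.
rewrite !inE /= !in_itv/= !andbT t0 (ltW s0) => /(_ isT isT).
by rewrite !convRE /=.
Qed.

End PowerFunctions.

Section EuclideanNorm.
Context {R : realType} {n : nat}.
Implicit Types (z h : 'rV[R]_n) (p : R).

Lemma mx_norm_coord z i : `|z ord0 i| <= `|z|.
Proof.
have -> : `|z| = mx_norm z by [].
by rewrite mx_normrE; exact: (le_bigmax _ _ (ord0, i)).
Qed.

Lemma mx_norm_le z (d : R) : 0 <= d -> (forall i, `|z ord0 i| <= d) -> `|z| <= d.
Proof.
move=> d0 zd; have -> : `|z| = mx_norm z by [].
by rewrite mx_normrE; apply: bigmax_le => // -[i j] _; rewrite ord1.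
Qed.

Definition dotv z h : R := \sum_i z ord0 i * h ord0 i.

Definition enorm z : R := Num.sqrt (\sum_i z ord0 i ^+ 2).

Lemma enorm_ge0 z : 0 <= enorm z. Proof. exact: sqrtr_ge0. Qed.

Lemma sqr_enorm z : enorm z ^+ 2 = dotv z z.
Proof. by rewrite sqr_sqrtr// sumr_ge0// => i _; exact: sqr_ge0. Qed.

Lemma enormN z : enorm (- z) = enorm z.
Proof. by congr Num.sqrt; apply: eq_bigr => i _; rewrite mxE sqrrN. Qed.

Lemma enorm_coord z i : `|z ord0 i| <= enorm z.
Proof.
rewrite -sqrtr_sqr ler_wsqrtr// (bigD1 i)//= lerDl.
by apply: sumr_ge0 => j _; exact: sqr_ge0.
Qed.

Lemma enorm_eq0 z : enorm z = 0 -> z = 0.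
Proof.
move=> z0; apply/rowP => i; apply/eqP; rewrite mxE -normr_eq0 eq_le normr_ge0 andbT.
by rewrite -z0 enorm_coord.
Qed.

Lemma enorm_continuous : continuous enorm.
Proof.
move=> z; apply: (@continuous_comp _ _ _ (fun z => \sum_i z ord0 i ^+ 2) Num.sqrt).
  apply: continuous_big; first exact: add_continuous.
  move=> i _ h; apply: (@continuous_comp _ _ _ (fun h => h ord0 i) (fun t : R => t ^+ 2)).
    exact: coord_continuous.
  exact: exprn_continuous.
exact: sqrt_continuous.
Qed.

Lemma dotv_le_enorm z h : 0 < enorm z -> dotv z h <= enorm z * enorm h.
Proof.
move=> z0; have [h0|h0] := eqVneq (enorm h) 0.
  rewrite h0 mulr0 (enorm_eq0 h0) /dotv big1// => i _.
  by rewrite mxE mulr0.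
have zh0 : 0 < enorm z * enorm h by rewrite mulr_gt0// lt_neqAle eq_sym h0 enorm_ge0.
have : 0 <= \sum_i (enorm h * z ord0 i - enorm z * h ord0 i) ^+ 2.
  by apply: sumr_ge0 => i _; exact: sqr_ge0.
have -> : \sum_i (enorm h * z ord0 i - enorm z * h ord0 i) ^+ 2 =
    enorm h ^+ 2 * dotv z z - 2 * (enorm z * enorm h) * dotv z h + enorm z ^+ 2 * dotv h h.
  rewrite /dotv !mulr_sumr -sumrB -big_split/=; apply: eq_bigr => i _; ring.
rewrite -!sqr_enorm => sq; rewrite -(ler_pM2l zh0); nra.
Qed.

Definition powR_gradient p z : 'rV[R]_n := enorm z `^ (p - 2) *: z.

Lemma powR_gradient_above_tangent p z h : 1 < p ->
  enorm z `^ p + p * dotv (powR_gradient p z) (h - z) <= enorm h `^ p.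
Proof.
move=> p1; have [z0|z0] := eqVneq (enorm z) 0.
  rewrite z0 powR0 ?gt_eqF//; last lra.
  rewrite /dotv big1 ?mulr0 ?addr0 ?powR_ge0// => i _.
  by rewrite /powR_gradient (enorm_eq0 z0) scaler0 mxE mul0r.
have {}z0 : 0 < enorm z by rewrite lt_neqAle eq_sym z0 enorm_ge0.
have p10 : 0 < p - 1 by rewrite subr_gt0.
apply: le_trans (powR_above_tangent (ltW p1) z0 (enorm_ge0 h)).
rewrite lerD2l -mulrA ler_pM2l; last lra.
have -> : dotv (powR_gradient p z) (h - z) = enorm z `^ (p - 2) * (dotv z h - enorm z ^+ 2).
  rewrite sqr_enorm /dotv -sumrB mulr_sumr; apply: eq_bigr => i _; rewrite !mxE; ring.
have -> : enorm z `^ (p - 1) = enorm z `^ (p - 2) * enorm z.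
  by rewrite -(mulr_powRB1 (enorm_ge0 z) p10) mulrC -addrA -opprD.
by rewrite -mulrA ler_wpM2l ?powR_ge0// mulrBr -expr2 lerD2r dotv_le_enorm.
Qed.

Lemma powR_enorm_continuous p : 0 < p -> continuous (fun z => enorm z `^ p).
Proof.
move=> p0 z; rewrite (_ : (fun z => _) = (fun t => `|t| `^ p) \o enorm); last first.
  by apply/funext => y; rewrite /= ger0_norm ?enorm_ge0.
by apply: continuous_comp; [exact: enorm_continuous|exact: norm_powR_continuous].
Qed.

Lemma powR_gradient_continuous p : 1 < p -> continuous (powR_gradient p).
Proof.
move=> p1 z; have [z0|z0] := eqVneq (enorm z) 0; last first.
  suff /cvgZ : {for z, continuous (fun h => enorm h `^ (p - 2))} by apply; exact: cvg_id.
  apply: (@continuous_comp _ _ _ enorm (@powR R ^~ (p - 2))); first exact: enorm_continuous.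
  apply/differentiable_continuous/derivable1_diffP/derivable_powR.
  by rewrite in_itv/= andbT lt_neqAle eq_sym z0 enorm_ge0.
have p10 : 0 < p - 1 by rewrite subr_gt0.
have bound h : `|powR_gradient p h| <= enorm h `^ (p - 1).
  apply: mx_norm_le => [|i]; first exact: powR_ge0.
  rewrite -(mulr_powRB1 (enorm_ge0 h) p10) mulrC -addrA -opprD.
  by rewrite mxE normrM ger0_norm ?powR_ge0// ler_wpM2l ?powR_ge0// enorm_coord.
have grad0 : powR_gradient p z = 0 by rewrite /powR_gradient (enorm_eq0 z0) scaler0.
suff /norm_cvg0P : `|powR_gradient p h| @[h --> z] --> (0 : R).
  by rewrite /continuous_at grad0.
apply: (@squeeze_cvgr _ (nbhs z) _ _ (cst 0) (fun h => enorm h `^ (p - 1))).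
- by apply: nearW => h; rewrite normr_ge0 bound.
- exact: cvg_cst.
- by have := @powR_enorm_continuous _ p10 z; rewrite /continuous_at z0 powR0 ?gt_eqF.
Qed.

Lemma closed_ball_compact (B : R) : compact [set z : 'rV[R]_n | `|z| <= B].
Proof.
apply: bounded_closed_compact.
  exists B; split; first exact: num_real.
  by move=> M BM z zB; exact: le_trans zB (ltW BM).
apply: (preimage_closed (f := fun z : 'rV[R]_n => `|z|) (D := [set t : R | t <= B])).
  by move=> z _; exact: norm_continuous.
exact: closed_le.
Qed.

(* The tangent inequality at [z + h] and [z - h] bounds the second difference by the pairing
   of [h] with the oscillation of the gradient. *)
Lemma powR_enorm_second_difference p (B e : R) : 1 < p -> 0 < e ->
  exists2 d : R, 0 < d & forall z h, `|z| <= B -> `|h| < d ->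
    enorm (z + h) `^ p + enorm (z - h) `^ p - 2 * enorm z `^ p <= e * `|h|.
Proof.
move=> p1 e0; have p0 : 0 < p by lra.
pose t := e / (p * n.+1%:R); have t0 : 0 < t by rewrite divr_gt0// mulr_gt0.
have t2 : 0 < t / 2 by rewrite divr_gt0.
have [d d0 gd] := compact_uniform_continuity (@closed_ball_compact B)
  (powR_gradient_continuous p1) t2.
exists d => // z h zB hd; pose G := powR_gradient p.
have near_z k : `|k| < d -> `|G z - G (z + k)| <= t / 2.
  move=> kd; have := gd z (z + k) zB; rewrite -!ball_normE /ball_/= opprD addNKr normrN.
  by move=> /(_ kd) /ltW.
have GG : `|G (z + h) - G (z - h)| <= t.
  rewrite (splitr t) -(subrKA (G z)); apply: le_trans (ler_normD _ _) _.
  by rewrite distrC lerD// near_z// normrN.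
have up := powR_gradient_above_tangent (z + h) z p1.
have dn := powR_gradient_above_tangent (z - h) z p1.
have pair : dotv (G (z + h)) h - dotv (G (z - h)) h <= n.+1%:R * (t * `|h|).
  rewrite /dotv -sumrB; apply: (@le_trans _ _ (\sum_(i < n) t * `|h|)).
    apply: ler_sum => i _; rewrite -mulrBl; apply: le_trans (ler_norm _) _.
    rewrite normrM ler_pM ?mx_norm_coord//.
    by have := mx_norm_coord (G (z + h) - G (z - h)) i; rewrite !mxE => /le_trans; apply.
  by rewrite sumr_const card_ord -[_ *+ n]mulr_natl ler_wpM2r ?ler_nat// mulr_ge0// ltW.
have dotN (g : 'rV[R]_n) : dotv g (- h) = - dotv g h.
  by rewrite /dotv -sumrN; apply: eq_bigr => i _; rewrite mxE mulrN.
rewrite opprD addNKr dotN -/G in up; rewrite opprB addrCA subrr addr0 -/G in dn.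
have -> : e * `|h| = p * (n.+1%:R * (t * `|h|)).
  have := pnatr_eq0 R n.+1; rewrite /t; move: n.+1%:R => m /negbT m0.
  by field; rewrite m0 gt_eqF.
by move: pair; rewrite -(ler_pM2l p0); lra.
Qed.

End EuclideanNorm.

(** * The c-transform *)

Definition bounded_on {R : realType} {X : Type} (Om : set X) (h : X -> R) : Prop :=
  exists M : R, forall x, Om x -> `|h x| <= M.

Definition ctransform {R : realType} {X : Type} (Om : set X) (c : X -> X -> R)
  (h : X -> R) (y : X) : R := inf [set c x y - h x | x in Om].

Definition cconcave {R : realType} {X : Type} (Om : set X) (c : X -> X -> R)
  (psi : X -> R) : Prop :=
  exists phi : X -> R, forall y, Om y -> (psi y)%:E = ereal_inf [set (c x y - phi x)%:E | x in Om].

(* 1-Lipschitz for the pseudometric [fun x x' => sup_y |c x y - c x' y|]. *)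
Definition cost_lipschitz {R : realType} {X : Type} (Om : set X) (c : X -> X -> R)
  (h : X -> R) : Prop :=
  forall x x' (e : R), Om x -> Om x' ->
    (forall y, Om y -> `|c x y - c x' y| <= e) -> `|h x - h x'| <= e.

Record bounded_cost {R : realType} {X : Type} (Om : set X) (c : X -> X -> R) : Prop := {
  cost_domain_neq0 : Om !=set0;
  cost_ge0 : forall x y, 0 <= c x y;
  cost_bounded : exists C : R, forall x y, Om x -> Om y -> c x y <= C;
  cost_sym : forall x y, c x y = c y x }.

Section CTransform.
Context {R : realType} {X : Type} {Om : set X} {c : X -> X -> R}.
Hypothesis Hc : bounded_cost Om c.
Implicit Types (h psi : X -> R) (x y : X) (a b e m : R).
Local Notation ct := (ctransform Om c).

Lemma ctransform_has_inf h y : bounded_on Om h -> has_inf [set c x y - h x | x in Om].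
Proof.
move=> [M hM]; split; first by have [x Ox] := cost_domain_neq0 Hc; exists (c x y - h x), x.
exists (- M) => _ [x Ox <-].
have := hM x Ox; have := cost_ge0 Hc x y; rewrite ler_norml => ? /andP[? ?]; lra.
Qed.

Lemma ctransform_le h x y : bounded_on Om h -> Om x -> ct h y <= c x y - h x.
Proof.
move=> bh Ox; apply: ge_inf; last by exists x.
by have [] := ctransform_has_inf y bh.
Qed.

Lemma le_ctransform h y m : (forall x, Om x -> m <= c x y - h x) -> m <= ct h y.
Proof.
move=> hm; apply: lb_le_inf; last by move=> _ [x Ox <-]; exact: hm.
by have [x Ox] := cost_domain_neq0 Hc; exists (c x y - h x), x.
Qed.

Lemma ctransform_adherent h y e : bounded_on Om h -> 0 < e ->
  exists2 x, Om x & c x y - h x < ct h y + e.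
Proof.
by move=> bh e0; have [_ [x Ox <-] ?] := inf_adherent e0 (ctransform_has_inf y bh); exists x.
Qed.

Lemma ctransform_EFin h y : bounded_on Om h ->
  ereal_inf [set (c x y - h x)%:E | x in Om] = (ct h y)%:E.
Proof.
move=> bh; have [ne lb] := ctransform_has_inf y bh.
rewrite -ereal_inf_EFin//; congr ereal_inf.
apply/seteqP; split => [_ [x Ox <-]|_ [_ [x Ox <-] <-]]; last by exists x.
by exists (c x y - h x) => //; exists x.
Qed.

Lemma ctransform_shift h h' y a : bounded_on Om h -> (forall x, Om x -> h' x = h x + a) ->
  ct h' y = ct h y - a.
Proof.
move=> bh h'E; have bh' : bounded_on Om h'.
  have [M hM] := bh; exists (M + `|a|) => x Ox; rewrite h'E//.
  by apply: le_trans (ler_normD _ _) _; rewrite lerD2r hM.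
apply: le_anti; rewrite lerBrDr le_ctransform => [|x Ox]; last first.
  by have := ctransform_le y bh' Ox; rewrite h'E//; lra.
apply: le_ctransform => x Ox; rewrite h'E//.
by have := ctransform_le y bh Ox; lra.
Qed.

Lemma cost_lipschitz_le h :
  (forall x x' e, Om x -> Om x' -> (forall y, Om y -> c x y <= c x' y + e) -> h x <= h x' + e) ->
  cost_lipschitz Om c h.
Proof.
move=> hle x x' e Ox Ox' xx'.
have sub y z : Om y -> Om z -> (forall w, Om w -> `|c y w - c z w| <= e) -> h y - h z <= e.
  move=> Oy Oz yz; rewrite lerBlDl; apply: hle => // w Ow.
  by rewrite -lerBlDl; apply: le_trans (ler_norm _) (yz w Ow).
rewrite ler_norml sub// andbT lerNl opprB sub// => y Oy.
by rewrite distrC xx'.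
Qed.

Lemma cost_lipschitz_bounded h : cost_lipschitz Om c h -> bounded_on Om h.
Proof.
have [x0 Ox0] := cost_domain_neq0 Hc; have [C cC] := cost_bounded Hc.
move=> lh; exists (`|h x0| + C) => x Ox; rewrite -[h x](subrKC (h x0)).
apply: le_trans (ler_normD _ _) _; rewrite lerD2l; apply: lh => // y Oy.
have := cost_ge0 Hc x y; have := cost_ge0 Hc x0 y.
by have := cC _ _ Ox Oy; have := cC _ _ Ox0 Oy; rewrite ler_norml => ? ? ? ?; apply/andP; lra.
Qed.

Lemma cconcave_lipschitz psi : cconcave Om c psi -> cost_lipschitz Om c psi.
Proof.
move=> [phi psiE]; apply: cost_lipschitz_le => x x' e Ox Ox' xx'.
rewrite -lee_fin EFinD -leeBlDr// (psiE x' Ox'); apply: le_ereal_inf_tmp => _ [y Oy <-].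
rewrite -EFinB lee_fin; apply: (@le_trans _ _ (c y x - phi y - e)).
  by rewrite lerB// -lee_fin psiE//; apply: ereal_inf_lbound; exists y.
by have := xx' y Oy; rewrite !(cost_sym Hc _ y); lra.
Qed.

Lemma ctransform_cconcave h : bounded_on Om h -> cconcave Om c (ct h).
Proof. by move=> bh; exists h => y _; rewrite ctransform_EFin. Qed.

Lemma ctransform_lipschitz h : bounded_on Om h -> cost_lipschitz Om c (ct h).
Proof. by move=> /ctransform_cconcave/cconcave_lipschitz. Qed.

Lemma ctransform_bounded h : bounded_on Om h -> bounded_on Om (ct h).
Proof. by move=> /ctransform_lipschitz/cost_lipschitz_bounded. Qed.

Lemma le_ctransformK h y : bounded_on Om h -> Om y -> h y <= ct (ct h) y.
Proof.
move=> bh Oy; apply: le_ctransform => x Ox.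
have := ctransform_le x bh Oy; rewrite (cost_sym Hc y x); lra.
Qed.

Lemma cconcaveK psi y : cconcave Om c psi -> Om y -> ct (ct psi) y = psi y.
Proof.
move=> cpsi Oy; have bpsi := cost_lipschitz_bounded (cconcave_lipschitz cpsi).
apply/eqP; rewrite eq_le le_ctransformK// andbT; have [phi psiE] := cpsi.
rewrite -lee_fin psiE//; apply: le_ereal_inf_tmp => _ [x Ox <-]; rewrite lee_fin.
apply: le_trans (ctransform_le y (ctransform_bounded bpsi) Ox) _; rewrite lerB//.
apply: le_ctransform => z Oz; rewrite lerBrDr -lerBrDl (cost_sym Hc z) -lee_fin psiE//.
by apply: ereal_inf_lbound; exists x.
Qed.

Lemma cost_lipschitz_conv h h' a b : 0 <= a -> 0 <= b -> a + b = 1 ->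
  cost_lipschitz Om c h -> cost_lipschitz Om c h' ->
  cost_lipschitz Om c (fun x => a * h x + b * h' x).
Proof.
move=> a0 b0 ab lh lh' x x' e Ox Ox' xx'; rewrite opprD addrACA -!mulrBr.
apply: le_trans (ler_normD _ _) _; rewrite !normrM (ger0_norm a0) (ger0_norm b0).
by rewrite -[e]mul1r -ab mulrDl lerD// ler_wpM2l// ?lh ?lh'.
Qed.

Lemma cost_lipschitz_difference h h' x x' e :
  cost_lipschitz Om c h -> cost_lipschitz Om c h' -> Om x -> Om x' ->
  (forall y, Om y -> `|c x y - c x' y| <= e) -> `|(h x - h' x) - (h x' - h' x')| <= e + e.
Proof.
move=> lh lh' Ox Ox' xx'; have := lh x x' e Ox Ox' xx'; have := lh' x x' e Ox Ox' xx'.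
by rewrite !ler_norml => /andP[? ?] /andP[? ?]; apply/andP; split; lra.
Qed.

End CTransform.

(** * Densities and couplings *)

Definition measurable_fibers {d : measure_display} {T : measurableType d} {I : finType}
  (k : T -> I) : Prop := forall i, measurable (k @^-1` [set i]).

Section Measurability.
Context {d : measure_display} {T : measurableType d} {R : realType}.

Lemma measurable_fibers_comp {I : finType} (k : T -> I) (w : I -> R) D :
  measurable D -> measurable_fibers k -> measurable_fun D (w \o k).
Proof.
move=> mD mk _ Y _; apply: measurableI => //.
rewrite (_ : _ @^-1` _ = \bigcup_(i in w @^-1` Y) (k @^-1` [set i])).
  by apply: fin_bigcup_measurable; [exact: finite_finset|move=> i _].
by apply/seteqP; split => [x Yx|x [i Yi /= ->]]; [exists (k x)|].
Qed.

Lemma nondecreasing_ge0_comp_measurable (g : R -> R) (D : set T) (u : T -> R) :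
  {in Num.nneg &, {homo g : s t / s <= t}} -> measurable D -> measurable_fun D u ->
  (forall x, D x -> 0 <= u x) -> measurable_fun D (g \o u).
Proof.
move=> g_nd mD um u0; apply: (eq_measurable_fun ((fun t => g (Num.max 0 t)) \o u)).
  by move=> x /set_mem /u0 ux /=; rewrite max_r.
apply: (measurable_comp measurableT) => //.
apply: nondecreasing_measurable => // s t st; apply: g_nd.
- by rewrite nnegrE le_max lexx.
- by rewrite nnegrE le_max lexx.
- by rewrite ge_max !le_max lexx st orbT.
Qed.

End Measurability.

Section Densities.
Context {d : measure_display} {T : measurableType d} {R : realType}.
Implicit Types (m : {measure set T -> \bar R}) (P Q : probability T R) (D A : set T).

Lemma measure_probability m : m setT = 1%E -> exists P, forall A, P A = m A.
Proof.
move=> m1; exists (mnormalize m (dirac point)) => A.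
by rewrite /= /mnormalize m1 onee_eq0 /= invr1 mule1.
Qed.

Definition has_density m D (P : {measure set T -> \bar R}) (u : T -> R) : Prop :=
  measurable_fun D u /\ (forall x, D x -> 0 <= u x) /\
  forall A, measurable A -> P A = (\int[m]_(x in A `&` D) (u x)%:E)%E.

Section DensityMeasure.
Context (m : {measure set T -> \bar R}) (s : T -> \bar R).
Hypotheses (ms : measurable_fun setT s) (s0 : forall x, (0 <= s x)%E).

Definition density_measure (_ : measurable_fun setT s) (_ : forall x, (0 <= s x)%E)
  (A : set T) : \bar R := (\int[m]_(x in A) s x)%E.

Local Notation g := (density_measure ms s0).

Let g0 : g set0 = 0%E. Proof. exact: integral_set0. Qed.
Let gge0 A : (0 <= g A)%E. Proof. exact: integral_ge0. Qed.
Let gsa : semi_sigma_additive g. Proof. exact: semi_sigma_additive_nng_induced. Qed.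

HB.instance Definition _ := isMeasure.Build _ _ _ g g0 gge0 gsa.

Lemma density_probability : (\int[m]_x s x = 1)%E ->
  exists P, forall A, P A = (\int[m]_(x in A) s x)%E.
Proof. by move=> /(@measure_probability g). Qed.

End DensityMeasure.

Lemma has_density_exists m D (u : T -> R) : measurable D -> measurable_fun D u ->
  (forall x, D x -> 0 <= u x) -> (\int[m]_(x in D) (u x)%:E = 1)%E ->
  exists P, has_density m D P u.
Proof.
move=> mD um u0 u1.
have [||| P PE] := @density_probability m ((EFin \o u) \_ D).
- by apply/(measurable_restrictT _ mD); exact/measurable_EFinP.
- by move=> x; rewrite patchE; case: ifPn => // /set_mem Dx; rewrite lee_fin u0.
- by rewrite -integral_mkcond.
exists P; split => //; split => // A mA.
by apply: etrans (PE A) _; rewrite -integral_mkcondr.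
Qed.

Import HBNNSimple.

Let has_density_integral_nnsfun m m' D (u : T -> R) (k : {nnsfun T >-> R}) : measurable D ->
  has_density m D m' u ->
  (\int[m']_(x in D) (k x)%:E = \int[m]_(x in D) ((k x)%:E * (u x)%:E))%E.
Proof.
move=> mD [um [u0 m'E]]; have muE : measurable_fun D (EFin \o u) by exact/measurable_EFinP.
pose level r := k @^-1` [set r]; have mlevel r : measurable (level r).
  by apply: measurable_funPTI; exact: measurable_set1.
have term_ge0 r x : (0 <= (r * \1_(level r) x)%:E)%E by exact: nnfun_muleindic_ge0.
have mterm r : measurable_fun D (fun x => (r * \1_(level r) x)%:E).
  by apply/measurable_EFinP; exact: measurable_funM.
have kE x : ((k x)%:E = \sum_(r \in range k) (r * \1_(level r) x)%:E)%E.
  by rewrite fimfunE -fsumEFin.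
under [LHS]eq_integral do rewrite kE.
rewrite ge0_integral_fsum//.
under [RHS]eq_integral do rewrite kE ge0_mule_fsuml//.
rewrite ge0_integral_fsum//; last 2 first.
- by move=> r; exact: emeasurable_funM.
- by move=> r x Dx; rewrite mule_ge0// lee_fin u0.
apply: eq_fsbigr => r /set_mem[y _ ry]; have r0 : 0 <= r by rewrite -ry.
under [LHS]eq_integral do rewrite EFinM.
rewrite integralZl_indic_nnsfun// integral_indic// m'E; last exact: measurableI.
under [RHS]eq_integral do rewrite EFinM -muleA.
have mind : measurable_fun D (EFin \o (\1_(level r) : T -> R)) by exact/measurable_EFinP.
rewrite ge0_integralZl//; last 2 first.
- exact: emeasurable_funM.
- by move=> x Dx; rewrite mule_ge0// lee_fin u0.
congr (_ * _)%E; rewrite -setIA setIid setIC integral_mkcondr.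
by apply: eq_integral => x _; rewrite epatch_indic muleC.
Qed.

Lemma has_density_integral m m' D (u : T -> R) (h : T -> \bar R) : measurable D ->
  has_density m D m' u -> measurable_fun D h -> (forall x, D x -> (0 <= h x)%E) ->
  (\int[m']_(x in D) h x = \int[m]_(x in D) (h x * (u x)%:E))%E.
Proof.
move=> mD hu mh h0; have [um [u0 _]] := hu; pose k := nnsfun_approx mD mh.
have kcvg x : D x -> EFin \o k^~ x @ \oo --> h x by move=> Dx; exact: cvg_nnsfun_approx.
have k_nd x : {homo (fun n => k n x) : a b / (a <= b)%N >-> a <= b}.
  by move=> a b ab; exact/lefP/nd_nnsfun_approx.
have mk n : measurable_fun D (EFin \o k n) by exact/measurable_EFinP/measurable_funTS.
have muE : measurable_fun D (EFin \o u) by exact/measurable_EFinP.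
transitivity (limn (fun n => (\int[m']_(x in D) (k n x)%:E)%E)).
  rewrite -monotone_convergence//.
  - by apply: eq_integral => x /set_mem Dx; apply/esym/cvg_lim => //; exact: kcvg.
  - by move=> n x Dx; rewrite lee_fin.
  - by move=> x Dx a b ab; rewrite lee_fin k_nd.
transitivity (limn (fun n => (\int[m]_(x in D) ((k n x)%:E * (u x)%:E))%E)); last first.
  rewrite -monotone_convergence//.
  - apply: eq_integral => x /set_mem Dx; apply/cvg_lim => //.
    by apply: cvgeZr => //; exact: kcvg.
  - by move=> n; exact: (emeasurable_funM (mk n) muE).
  - by move=> n x Dx; rewrite mule_ge0 ?lee_fin ?u0.
  - by move=> x Dx a b ab; rewrite lee_wpmul2r ?lee_fin ?u0 ?k_nd.
by under eq_fun do rewrite (has_density_integral_nnsfun _ mD hu).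
Qed.

End Densities.

Section AlmostEverywhere.
Context {d : measure_display} {T : measurableType d} {R : realType}.
Implicit Types (m : {measure set T -> \bar R}) (P Q : probability T R) (D A E : set T).

Lemma ae_notin m E : measurable E -> m E = 0%E -> {ae m, forall x, ~ E x}.
Proof.
move=> mE E0; have := (negligibleP m mE).2 E0; apply: negligibleS => x /= nnE.
exact: contrapT.
Qed.

Lemma probability1_ae P A : measurable A -> P A = 1%E -> {ae P, forall x, A x}.
Proof.
move=> mA PA; have PCA : P (~` A) = 0%E by rewrite probability_setC// PA subee.
by apply: filterS (ae_notin (measurableC mA) PCA) => x nnA; exact: contrapT.
Qed.

Lemma probability_setI1 P A B : measurable A -> measurable B -> P A = 1%E -> P B = 1%E ->
  P (A `&` B) = 1%E.
Proof.
move=> mA mB PA PB; have mAB : measurable (A `&` B) by exact: measurableI.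
have nullC E : measurable E -> P E = 1%E -> P (~` E) = 0%E.
  by move=> mE PE; rewrite probability_setC// PE subee.
rewrite -[A `&` B]setCK probability_setC; last exact: measurableC.
suff -> : P (~` (A `&` B)) = 0%E by rewrite sube0.
apply: (negligibleP P (measurableC mAB)).1; rewrite setCI.
by apply: negligibleU; apply: (negligibleP P (measurableC _)).2 => //; exact: nullC.
Qed.

Lemma integral_gt0_null m E (g : T -> R) : measurable E -> measurable_fun E g ->
  {ae m, forall x, E x -> 0 < g x} -> (\int[m]_(x in E) (g x)%:E = 0)%E -> m E = 0%E.
Proof.
move=> mE mg g_gt0 g0; have mgE : measurable_fun E (EFin \o g) by exact/measurable_EFinP.
have : ae_eq m E (EFin \o g) (cst 0%E).
  apply/(ae_eq_integral_abs m mE mgE); rewrite -[RHS]g0.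
  apply: ae_eq_integral => //; first exact: measurableT_comp.
  by apply: filterS g_gt0 => x h /h gx; rewrite /= ger0_norm// ltW.
move=> g_ae0; have nE : {ae m, forall x, ~ E x}.
  by apply: filterS2 g_gt0 g_ae0 => x gx gx0 Ex; have := gx Ex; have [->] := gx0 Ex; rewrite ltxx.
by apply: (negligibleP m mE).1; apply: negligibleS nE => x Ex /=; exact.
Qed.

Lemma ae_ge0_integral_norm m D (f : T -> R) : measurable D -> m.-integrable D (EFin \o f) ->
  {ae m, forall x, D x -> 0 <= f x} ->
  (\int[m]_(x in D) `|(f x)%:E| = (\int[m]_(x in D) f x)%:E)%E.
Proof.
move=> mD fi f0; have mf := measurable_int _ fi.
rewrite fineK ?integrable_fin_num//; apply: ae_eq_integral => //; first exact: measurableT_comp.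
by apply: filterS f0 => x + Dx => /(_ Dx) ? /=; rewrite ger0_norm.
Qed.

Lemma ae_ge0_Rintegral_eq0 m D (f : T -> R) : measurable D -> m.-integrable D (EFin \o f) ->
  {ae m, forall x, D x -> 0 <= f x} -> \int[m]_(x in D) f x <= 0 ->
  {ae m, forall x, D x -> f x = 0}.
Proof.
move=> mD fi f0 int_le0; suff /(ae_eq_integral_abs m mD (measurable_int _ fi)) :
    (\int[m]_(x in D) `|(f x)%:E| = 0)%E by apply: filterS => x + Dx => /(_ Dx)[].
apply: le_anti; apply/andP; split; last exact: integral_ge0.
by rewrite ae_ge0_integral_norm.
Qed.

Lemma has_density_ae m m' D (u : T -> R) (A : set T) : measurable D -> has_density m D m' u ->
  {ae m, forall x, D x -> A x} -> {ae m', forall x, D x -> A x}.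
Proof.
move=> mD [um [u0 m'E]] [N [mN N0 DAN]]; exists N; split => //.
have mND : measurable (N `&` D) by exact: measurableI.
rewrite m'E// null_set_integral//.
  by apply/measurable_EFinP; apply: measurable_funS um => // x [].
by apply: subset_measure0 N0 => //; exact: subIsetl.
Qed.

Lemma ae_has_density m m' D (u : T -> R) (A : set T) : measurable D -> has_density m D m' u ->
  {ae m', forall x, D x -> A x} -> {ae m, forall x, D x -> 0 < u x -> A x}.
Proof.
move=> mD [um [u0 m'E]] [N [mN N0 DAN]].
pose E := N `&` (D `&` u @^-1` `]0, +oo[).
have mE : measurable E by apply: measurableI => //; exact: um.
have E0 : m E = 0%E.
  apply: (@integral_gt0_null m E u) => //.
  - by apply: measurable_funS um => // x [_ []].
  - by apply: aeW => x [_ [_]]; rewrite /= in_itv/= andbT.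
  apply/eqP; rewrite eq_le integral_ge0 ?andbT; last first.
    by move=> x [_ [Dx _]]; rewrite lee_fin u0.
  rewrite -N0 m'E//; apply: ge0_subset_integral => //.
  - exact: measurableI.
  - by apply/measurable_EFinP; apply: measurable_funS um => // x [].
  - by move=> x [_ Dx]; rewrite lee_fin u0.
  - by move=> x [Nx [Dx _]].
apply: filterS (ae_notin mE E0) => x nE Dx ux; apply: contrapT => nA.
apply: nE; split; last by split => //=; rewrite in_itv/= ux.
by apply: DAN => /= /(_ Dx).
Qed.

Lemma has_density_unique m m' D (u w : T -> R) : measurable D -> (m' D < +oo)%E ->
  has_density m D m' u -> has_density m D m' w -> {ae m, forall x, D x -> u x = w x}.
Proof.
move=> mD m'D [um [u0 uE]] [mw [w0 wE]].
have : ae_eq m D (EFin \o u) (EFin \o w).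
  apply: integral_ae_eq => //; try exact/measurable_EFinP.
    apply/integrableP; split; first exact/measurable_EFinP.
    under eq_integral => x /set_mem Dx do rewrite /= ger0_norm ?u0//.
    by rewrite -[X in integral _ X _]setIid -uE.
  by move=> E ED mE; have := uE E mE; rewrite wE// (setIidl ED).
by apply: filterS => x uw /uw[].
Qed.

Lemma probability_mixture P Q (e : R) : 0 <= e <= 1 ->
  exists M : probability T R,
    (forall A, M A = (1 - e)%:E * P A + e%:E * Q A)%E /\
    (forall h : T -> \bar R, measurable_fun setT h -> (forall x, 0 <= h x)%E ->
       \int[M]_x h x = (1 - e)%:E * \int[P]_x h x + e%:E * \int[Q]_x h x)%E.
Proof.
move=> /andP[e0 e1]; have e1' : 0 <= 1 - e by rewrite subr_ge0.
pose m : {measure set T -> \bar R} :=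
  measure_add (mscale (NngNum e1') P) (mscale (NngNum e0) Q).
have mE A : m A = ((1 - e)%:E * P A + e%:E * Q A)%E by exact: measure_addE.
have [|M ME] := @measure_probability _ _ _ m.
  by apply: etrans (mE setT) _; rewrite !probability_setT !mule1 -EFinD subrK.
exists M; split => [A|h mh h0]; first exact: etrans (ME A) (mE A).
rewrite (eq_measure_integral m) => [|A mA _]; last exact: ME.
by rewrite ge0_integral_measure_add// !ge0_integral_mscale.
Qed.

Lemma density_coupling P Q (s : T * T -> \bar R) : measurable_fun setT s ->
  (forall z, (0 <= s z)%E) -> (forall y, \int[P]_x s (x, y) = 1)%E ->
  exists S : probability (T * T)%type R,
    (forall N, S N = \int[(P \x Q)%E]_(z in N) s z)%E /\
    forall A, measurable A ->
      S (A `*` setT) = (\int[P]_(x in A) \int[Q]_y s (x, y))%E /\ S (setT `*` A) = Q A.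
Proof.
move=> ms s0 s1.
have rectE A B x y : ((s \_ (A `*` B)) (x, y) = ((fun x => ((fun y => s (x, y)) \_ B) y) \_ A) x)%E.
  by rewrite !patchE in_setX; case: (x \in A) => //=; case: (y \in B).
have rect_measurable A B : measurable A -> measurable B -> measurable_fun setT (s \_ (A `*` B)).
  by move=> mA mB; apply/(measurable_restrictT _ (measurableX mA mB)); exact: measurable_funTS.
have rect_ge0 A B z : (0 <= (s \_ (A `*` B)) z)%E by rewrite patchE; case: ifP.
have snd_marginal A : measurable A -> (\int[(P \x Q)%E]_(z in setT `*` A) s z = Q A)%E.
  move=> mA; rewrite integral_mkcond fubini_tonelli2//; last exact: rect_measurable.
  rewrite -[RHS](mul1e (Q A)) -(integral_cst Q mA) integral_mkcond; apply: eq_integral => y _.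
  rewrite /fubini_G patchE; case: ifPn => Ay.
    by rewrite -[RHS](s1 y); apply: eq_integral => x _; rewrite rectE !patchE in_setT Ay.
  by rewrite integral0_eq// => x _; rewrite rectE !patchE in_setT (negbTE Ay).
have [|S SE] := density_probability (m := (P \x Q)%E) ms s0.
  by rewrite -setXTT snd_marginal// probability_setT.
exists S; split=> [//|A mA]; rewrite !SE; split; last exact: snd_marginal.
rewrite integral_mkcond fubini_tonelli1//; last exact: rect_measurable.
rewrite [RHS]integral_mkcond; apply: eq_integral => x _; rewrite /fubini_F patchE; case: ifPn => Ax.
  by apply: eq_integral => y _; rewrite rectE !patchE Ax in_setT.
by rewrite integral0_eq// => y _; rewrite rectE !patchE (negbTE Ax).
Qed.

Lemma fatou_le m D (f : nat -> T -> \bar R) (g : T -> \bar R) (L : \bar R) : measurable D ->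
  (forall n, measurable_fun D (f n)) -> (forall n x, D x -> (0 <= f n x)%E) ->
  (forall x, D x -> f^~ x @ \oo --> g x) -> (forall n, \int[m]_(x in D) f n x <= L)%E ->
  (\int[m]_(x in D) g x <= L)%E.
Proof.
move=> mD mf f0 fg fL.
rewrite (eq_integral (fun x => limn_einf (f^~ x))) => [|x /set_mem/fg/cvg_limn_einf_sup[->]//].
apply: (le_trans (fatou m mD mf f0)); rewrite limn_einf_lim; apply: lime_le.
  exact: is_cvg_einfs.
by apply: nearW => n; apply: ereal_inf_le; exists (\int[m]_(x in D) f n x)%E; first exists n => /=.
Qed.

Lemma has_density_mixture m D (P Q M : probability T R) (u r : T -> R) (e : R) :
  measurable D -> 0 <= e <= 1 -> has_density m D P u -> has_density m D Q r ->
  (forall A, M A = (1 - e)%:E * P A + e%:E * Q A)%E ->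
  has_density m D M (fun x => (1 - e) * u x + e * r x).
Proof.
move=> mD /andP[e0 e1] [um [u0 PE]] [mr [r0 QE]] ME; have e1' : 0 <= 1 - e by rewrite subr_ge0.
split; first by apply: measurable_funD; apply: measurable_funM.
split=> [x Dx|A mA]; first by rewrite addr_ge0// mulr_ge0// ?u0 ?r0.
have mAD : measurable (A `&` D) by exact: measurableI.
have mEFin (k : T -> R) : measurable_fun D k -> measurable_fun (A `&` D) (EFin \o k).
  by move=> mk; apply/measurable_EFinP; apply: measurable_funS mk => // x [].
apply: etrans (ME A) _; rewrite [P A]PE// [Q A]QE//.
rewrite -!ge0_integralZl_EFin//; try (by move=> x [_ Dx]; rewrite lee_fin ?u0 ?r0);
  try exact: mEFin.
rewrite -ge0_integralD//; try (by move=> x [_ Dx]; rewrite -EFinM lee_fin mulr_ge0 ?u0 ?r0);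
  by apply: measurable_funeM; exact: mEFin.
Qed.

Lemma has_density_domain m D P (u : T -> R) : measurable D -> has_density m D P u -> P D = 1%E.
Proof.
move=> mD [_ [_ PE]]; rewrite -(@probability_setT _ _ _ P).
by apply: etrans (PE _ mD) (esym (etrans (PE _ measurableT) _)); rewrite setTI setIid.
Qed.

Lemma uniform_probability m D : measurable D -> (0 < m D)%E -> (m D < +oo)%E ->
  exists P, has_density m D P (fun=> (fine (m D))^-1).
Proof.
move=> mD mD_gt0 mD_fin; have m0 : 0 < fine (m D) by rewrite fine_gt0// mD_gt0.
apply: has_density_exists => //; rewrite integral_cst//.
by rewrite -[X in (_ * X)%E]fineK ?ge0_fin_numE// -EFinM mulVf// gt_eqF.
Qed.

End AlmostEverywhere.

(** * Transport cost and weak duality *)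

Record transport_space {d : measure_display} {T : measurableType d} {R : realType}
    (Om : set T) (c : T -> T -> R) : Prop := {
  transport_cost_bounded :> bounded_cost Om c;
  transport_domain_measurable : measurable Om;
  transport_cost_measurable : measurable_fun setT (fun z : T * T => c z.1 z.2);
  transport_net : forall e : R, 0 < e -> exists (I : finType) (k : T -> I) (r : I -> T),
    [/\ measurable_fibers k, forall i, Om (r i) &
     forall x y, Om x -> Om y -> `|c x y - c (r (k x)) y| <= e] }.

Section Transport.
Context {d : measure_display} {T : measurableType d} {R : realType}.
Context (Om : set T) (c : T -> T -> R).
Hypothesis Hts : transport_space Om c.
Implicit Types (h : T -> R) (x y : T) (mu nu rho : probability T R).
Implicit Types (g : probability (T * T)%type R).
Local Notation ct := (ctransform Om c).

Let mO : measurable Om. Proof. exact: transport_domain_measurable Hts. Qed.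

Lemma cost_lipschitz_measurable h : cost_lipschitz Om c h -> measurable_fun Om h.
Proof.
move=> lh.
have /choice[w wh] : forall n, exists w : T -> R, measurable_fun Om w /\
    forall x, Om x -> `|h x - w x| <= n.+1%:R^-1.
  move=> n; have [|I [k [r [mk Or kr]]]] := transport_net Hts (e := n.+1%:R^-1).
    by rewrite invr_gt0.
  exists ((h \o r) \o k); split; first exact: measurable_fibers_comp.
  by move=> x Ox; apply: lh => // y; exact: kr.
apply: (measurable_fun_cvg (h := w)) => [n|x Ox]; first by case: (wh n).
apply/cvgrPdist_lt => e e0; near=> n; have [_ /(_ x Ox)] := wh n.
by move=> /le_lt_trans; apply; near: n; exact: near_infty_natSinv_lt (PosNum e0).
Unshelve. all: by end_near. Qed.

Lemma cost_lipschitz_integrable mu h : cost_lipschitz Om c h -> mu.-integrable Om (EFin \o h).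
Proof.
move=> lh; apply: measurable_bounded_integrable => //.
- exact: le_lt_trans (probability_le1 _ mO) (ltry _).
- exact: cost_lipschitz_measurable.
have [M hM] := cost_lipschitz_bounded Hts lh; exists M; split; first exact: num_real.
by move=> N MN x Ox; exact: le_trans (hM x Ox) (ltW MN).
Qed.

Definition is_plan mu nu g : Prop :=
  g (Om `*` Om) = 1%E /\ forall A, measurable A -> g (A `*` setT) = mu A /\ g (setT `*` A) = nu A.

Definition transport_cost mu nu : \bar R :=
  ereal_inf [set (\int[g]_z (c z.1 z.2)%:E)%E | g in is_plan mu nu].

Definition dual_value mu nu h : R :=
  \int[mu]_(x in Om) h x + \int[nu]_(y in Om) ct h y.

Lemma plan_ae mu nu g : is_plan mu nu g -> {ae g, forall z, Om z.1 /\ Om z.2}.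
Proof.
move=> [g1 _]; have := probability1_ae (measurableX mO mO) g1.
by apply: filterS => z [].
Qed.

Lemma plan_integral_fst mu nu g (h : T -> \bar R) : is_plan mu nu g ->
  measurable_fun setT h -> (forall x, 0 <= h x)%E -> (\int[g]_z h z.1 = \int[mu]_x h x)%E.
Proof.
move=> [_ gE] mh h0.
have mf : measurable_fun setT (fst : T * T -> T) by exact: measurable_fst.
rewrite (eq_measure_integral (pushforward g fst) (m1 := mu)); last first.
  by move=> A mA _; apply: etrans (esym (gE A mA).1) _; rewrite setXT.
by rewrite ge0_integral_pushforward.
Qed.

Lemma plan_integral_snd mu nu g (h : T -> \bar R) : is_plan mu nu g ->
  measurable_fun setT h -> (forall x, 0 <= h x)%E -> (\int[g]_z h z.2 = \int[nu]_y h y)%E.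
Proof.
move=> [_ gE] mh h0.
have mf : measurable_fun setT (snd : T * T -> T) by exact: measurable_snd.
rewrite (eq_measure_integral (pushforward g snd) (m1 := nu)); last first.
  by move=> A mA _; apply: etrans (esym (gE A mA).2) _; rewrite setTX.
by rewrite ge0_integral_pushforward.
Qed.

Lemma transport_cost_le mu nu g : is_plan mu nu g ->
  (transport_cost mu nu <= \int[g]_z (c z.1 z.2)%:E)%E.
Proof. by move=> pg; apply: ereal_inf_lbound; exists g. Qed.

Lemma transport_cost_ge0 mu nu : (0 <= transport_cost mu nu)%E.
Proof.
apply: le_ereal_inf_tmp => _ [g _ <-]; apply: integral_ge0 => z _.
by rewrite lee_fin (cost_ge0 Hts).
Qed.

Lemma product_plan mu nu : mu Om = 1%E -> nu Om = 1%E ->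
  is_plan mu nu (mu \x nu)%E.
Proof.
move=> muOm nuOm; split.
  by apply: etrans (product_measure1E _ _ mO mO) _; rewrite -[RHS]mule1; congr (_ * _)%E.
move=> A mA; split.
  apply: etrans (product_measure1E _ _ mA measurableT) _; rewrite -[RHS]mule1.
  by congr (_ * _)%E; exact: probability_setT.
apply: etrans (product_measure1E _ _ measurableT mA) _; rewrite -[RHS]mul1e.
by congr (_ * _)%E; exact: probability_setT.
Qed.

Lemma transport_cost_fin mu nu : mu Om = 1%E -> nu Om = 1%E ->
  transport_cost mu nu \is a fin_num.
Proof.
move=> muOm nuOm; have pl := product_plan muOm nuOm; have [C cC] := cost_bounded Hts.
rewrite ge0_fin_numE ?transport_cost_ge0//.
apply: le_lt_trans (transport_cost_le pl) _.
apply: (@le_lt_trans _ _ (\int[(mu \x nu)%E]_z `|C|%:E)%E); last first.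
  by rewrite integral_cst//= probability_setT mule1 ltry.
have mc : measurable_fun setT (fun z : T * T => (c z.1 z.2)%:E).
  by apply/measurable_EFinP; exact: transport_cost_measurable Hts.
apply: ae_ge0_le_integral => //; first by move=> z _; rewrite lee_fin (cost_ge0 Hts).
apply: filterS (plan_ae pl) => z [Oz1 Oz2] _; rewrite lee_fin.
by apply: le_trans (cC _ _ Oz1 Oz2) (ler_norm _).
Qed.

Lemma transport_cost_convex mu mu' nu rho (e : R) : 0 <= e <= 1 ->
  mu Om = 1%E -> mu' Om = 1%E -> nu Om = 1%E ->
  (forall A, rho A = (1 - e)%:E * mu A + e%:E * mu' A)%E ->
  (transport_cost rho nu <=
   (1 - e)%:E * transport_cost mu nu + e%:E * transport_cost mu' nu)%E.
Proof.
move=> e01 muOm mu'Om nuOm rhoE; apply/lee_addgt0Pr => t t0.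
have Tm := transport_cost_fin muOm nuOm; have Tm' := transport_cost_fin mu'Om nuOm.
have /andP[e0 e1] := e01.
have [_ [g pg <-] gt] := lb_ereal_inf_adherent t0 Tm.
have [_ [g' pg' <-] gt'] := lb_ereal_inf_adherent t0 Tm'.
have [G [GE GI]] := probability_mixture g g' e01.
have pG : is_plan rho nu G.
  have [g1 gE] := pg; have [g1' gE'] := pg'.
  split; first by rewrite GE g1 g1' !mule1 -EFinD subrK.
  move=> A mA; rewrite !GE; have [-> ->] := gE A mA; have [-> ->] := gE' A mA.
  split; first by rewrite rhoE.
  by rewrite -ge0_muleDl ?lee_fin ?subr_ge0// -EFinD subrK mul1e.
apply: le_trans (transport_cost_le pG) _; rewrite GI; last 2 first.
- by apply/measurable_EFinP; exact: transport_cost_measurable Hts.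
- by move=> z; rewrite lee_fin (cost_ge0 Hts).
apply: (@le_trans _ _ ((1 - e)%:E * (transport_cost mu nu + t%:E) +
    e%:E * (transport_cost mu' nu + t%:E)))%E.
  by apply: leeD; rewrite lee_wpmul2l ?lee_fin ?subr_ge0// ltW.
rewrite -(fineK Tm) -(fineK Tm') -!EFinD lee_fin.
by rewrite le_eqVlt; apply/orP; left; apply/eqP; ring.
Qed.

Definition shifted h (M : R) : T -> \bar R := (fun x => (h x + M)%:E) \_ Om.

Lemma shifted_measurable h M : cost_lipschitz Om c h -> measurable_fun setT (shifted h M).
Proof.
move=> lh; apply/(measurable_restrictT _ mO)/measurable_EFinP; apply: measurable_funD => //.
exact: cost_lipschitz_measurable.
Qed.

Lemma shifted_ge0 h M x : (forall x, Om x -> - M <= h x) -> (0 <= shifted h M x)%E.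
Proof.
by move=> hM; rewrite /shifted patchE; case: ifPn => // /set_mem/hM; rewrite lee_fin -lerBlDr sub0r.
Qed.

Lemma shifted_integral mu h M : mu Om = 1%E -> cost_lipschitz Om c h ->
  (\int[mu]_x shifted h M x = (\int[mu]_(x in Om) h x + M)%:E)%E.
Proof.
move=> muOm lh; have ih := cost_lipschitz_integrable mu lh.
rewrite -integral_mkcond; under eq_integral do rewrite EFinD.
rewrite integralD//; last exact: finite_measure_integrable_cst.
by rewrite integral_cst//= muOm mule1 EFinD fineK// integrable_fin_num.
Qed.

Lemma weak_duality mu nu h : mu Om = 1%E -> nu Om = 1%E -> cost_lipschitz Om c h ->
  ((dual_value mu nu h)%:E <= transport_cost mu nu)%E.
Proof.
move=> muOm nuOm lh; have bh := cost_lipschitz_bounded Hts lh.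
have lch := ctransform_lipschitz Hts bh; have bch := cost_lipschitz_bounded Hts lch.
have [M hM] := bh; have [M' hM'] := bch.
have hM_ge x : Om x -> - M <= h x by move=> /hM; rewrite ler_norml => /andP[].
have hM'_ge x : Om x -> - M' <= ct h x by move=> /hM'; rewrite ler_norml => /andP[].
apply: le_ereal_inf_tmp => _ [g pg <-].
have mc : measurable_fun setT (fun z : T * T => (c z.1 z.2)%:E).
  by apply/measurable_EFinP; exact: transport_cost_measurable Hts.
have mH : measurable_fun setT (shifted h M \o (fst : T * T -> T)).
  by apply: measurableT_comp; [exact: shifted_measurable|exact: measurable_fst].
have mH' : measurable_fun setT (shifted (ct h) M' \o (snd : T * T -> T)).
  by apply: measurableT_comp; [exact: shifted_measurable|exact: measurable_snd].
have M0 : 0 <= M + M'.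
  have [x Ox] := cost_domain_neq0 Hts.
  by apply: addr_ge0; [exact: le_trans (hM x Ox)|exact: le_trans (hM' x Ox)].
have : (\int[g]_z (shifted h M z.1 + shifted (ct h) M' z.2) <=
    \int[g]_z ((c z.1 z.2)%:E + (M + M')%:E))%E.
  apply: ae_ge0_le_integral => //.
  - by move=> z _; rewrite adde_ge0 ?shifted_ge0.
  - exact: emeasurable_funD.
  - by move=> z _; rewrite adde_ge0 ?lee_fin ?(cost_ge0 Hts).
  - exact: emeasurable_funD.
  apply: filterS (plan_ae pg) => z [Oz1 Oz2] _.
  rewrite /shifted !patchE !mem_set// -!EFinD lee_fin.
  by have := ctransform_le Hts z.2 bh Oz1; lra.
rewrite !ge0_integralD//; try by move=> z _; rewrite ?shifted_ge0// lee_fin (cost_ge0 Hts).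
rewrite (plan_integral_fst pg) ?(plan_integral_snd pg); try exact: shifted_measurable; last 2 first.
- by move=> x; exact: shifted_ge0.
- by move=> x; exact: shifted_ge0.
rewrite !shifted_integral// integral_cst//= probability_setT mule1 -EFinD addrACA EFinD.
by rewrite leeD2rE.
Qed.

Definition dual_maximizer mu nu psi : Prop :=
  cconcave Om c psi /\
  forall h, cost_lipschitz Om c h -> dual_value mu nu h <= dual_value mu nu psi.

(* Passing to the double c-transform does not decrease the dual value. *)
Lemma cconcave_dual_maximizer mu nu psi : cconcave Om c psi ->
  (forall h, cconcave Om c h -> dual_value mu nu h <= dual_value mu nu psi) ->
  dual_maximizer mu nu psi.
Proof.
move=> cpsi psi_max; split=> // h lh; have bh := cost_lipschitz_bounded Hts lh.
have bch := ctransform_bounded Hts bh; have cch := ctransform_cconcave Hts bh.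
apply: le_trans (psi_max (ct (ct h)) (ctransform_cconcave Hts bch)).
have -> : dual_value mu nu (ct (ct h)) =
    \int[mu]_(x in Om) ct (ct h) x + \int[nu]_(y in Om) ct h y.
  by congr (_ + _); apply: eq_Rintegral => y /set_mem; exact: (cconcaveK Hts).
rewrite lerD2r; apply: le_Rintegral => //; first exact: cost_lipschitz_integrable.
  exact/cost_lipschitz_integrable/(ctransform_lipschitz Hts).
by move=> x Ox; exact: (le_ctransformK Hts).
Qed.

End Transport.

(** * First-order optimality of an energy minimizer *)

Record convex_energy {R : realType} (f df : R -> R) : Prop := {
  energy_0 : f 0 = 0;
  energy_ge0 : forall t : R, 0 <= t -> 0 <= f t;
  energy_convex : forall x y l : R, 0 <= x -> 0 <= y -> x != y -> 0 < l < 1 ->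
    f (l * x + (1 - l) * y) < l * f x + (1 - l) * f y;
  energy_derive : forall t : R, 0 < t -> is_derive t (1 : R) f (df t);
  energy_derive_continuous : {within `[0, +oo[, continuous df};
  energy_derive_0 : df 0 = 0 }.

Section Energy.
Context {R : realType} {f df : R -> R}.
Hypothesis Hf : convex_energy f df.
Implicit Types s t : R.

Lemma energy_above_tangent s t : 0 <= s -> 0 <= t -> f s + df s * (t - s) <= f t.
Proof.
rewrite le_eqVlt => /predU1P[<- t0|s0 t0].
  by rewrite (energy_0 Hf) (energy_derive_0 Hf) mul0r add0r (energy_ge0 Hf).
apply: (convex_above_tangent (energy_derive Hf s0)) => r r01.
have [->|ts] := eqVneq t s; first by rewrite -!mulrDl addrC subrK !mul1r.
exact/ltW/(energy_convex Hf t0 (ltW s0) ts r01).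
Qed.

Lemma energy_derive_lt s t : 0 <= s -> s < t -> df s < df t.
Proof.
move=> s0 st; have t0 : 0 <= t by rewrite (le_trans s0)// ltW.
pose mid := 2^-1 * s + (1 - 2^-1) * t.
have mid0 : 0 <= mid by rewrite /mid; lra.
have tan_s := energy_above_tangent s0 mid0; have tan_t := energy_above_tangent t0 mid0.
have mid_lt : f mid < 2^-1 * f s + (1 - 2^-1) * f t.
  apply: (energy_convex Hf) => //; first by rewrite lt_eqF.
  by rewrite invr_gt0 ltr0n/= invf_lt1// ltr1n.
have mid_s : mid - s = (t - s) / 2 by rewrite /mid; field.
have mid_t : mid - t = - ((t - s) / 2) by rewrite /mid; field.
rewrite mid_s in tan_s; rewrite mid_t in tan_t.
by rewrite -(ltr_pM2r (_ : 0 < t - s)) ?subr_gt0//; lra.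
Qed.

Lemma energy_derive_le : {in Num.nneg &, {homo df : s t / s <= t}}.
Proof.
move=> s t s0 _; rewrite le_eqVlt => /predU1P[->//|st].
by apply: ltW; exact: energy_derive_lt.
Qed.

Lemma energy_derive_ge0 t : 0 <= t -> 0 <= df t.
Proof. by move=> t0; rewrite -(energy_derive_0 Hf) energy_derive_le ?nnegrE. Qed.

Lemma energy_derive_inj : {in Num.nneg &, injective df}.
Proof.
move=> s t s0 t0 dst; case: (ltgtP s t) => // st.
- by have := energy_derive_lt s0 st; rewrite dst ltxx.
- by have := energy_derive_lt t0 st; rewrite dst ltxx.
Qed.

Lemma energy_le : {in Num.nneg &, {homo f : s t / s <= t}}.
Proof.
move=> s t s0 t0 st; apply: le_trans (energy_above_tangent s0 t0).
by rewrite lerDl mulr_ge0 ?energy_derive_ge0// subr_ge0.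
Qed.

Lemma energy_derive_cvg (a : R^nat) s : 0 <= s -> (forall n, 0 <= a n) ->
  a @ \oo --> s -> df \o a @ \oo --> df s.
Proof.
move=> s0 a0 a_s; apply/cvgrPdist_lt => e e0.
have /subspace_continuousP/(_ s) := energy_derive_continuous Hf.
rewrite /= in_itv/= s0 => /(_ isT)/cvgrPdist_lt/(_ e e0)[r /= r0 near_s].
near=> n; apply: near_s; last by rewrite /= in_itv/= a0.
by rewrite /ball_ /=; near: n; move/cvgrPdist_lt: a_s => /(_ r r0).
Unshelve. all: by end_near. Qed.

End Energy.

Definition internal_energy {d : measure_display} {T : measurableType d} {R : realType}
  (m : {measure set T -> \bar R}) (Om : set T) (f : R -> R) (u : T -> R) : \bar R :=
  (\int[m]_(x in Om) (f (u x))%:E)%E.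

Section FirstVariation.
Context {d : measure_display} {T : measurableType d} {R : realType}.
Context {Om : set T} {c : T -> T -> R} {m : {measure set T -> \bar R}} {f df : R -> R}.
Hypotheses (Hts : transport_space Om c) (Hf : convex_energy f df).
Hypotheses (mOm_gt0 : (0 < m Om)%E) (mOm_fin : (m Om < +oo)%E).
Implicit Types (P : probability T R) (x : T).
Local Notation cost_to := (transport_cost Om c).
Local Notation energy := (internal_energy m Om f).

Let mO : measurable Om. Proof. exact: transport_domain_measurable Hts. Qed.

Let mOmE : m Om = (fine (m Om))%:E.
Proof. by rewrite fineK// ge0_fin_numE. Qed.

Let f_comp_measurable (u : T -> R) : measurable_fun Om u -> (forall x, Om x -> 0 <= u x) ->
  measurable_fun Om (fun x => (f (u x))%:E).
Proof.
move=> um u0; apply/measurable_EFinP.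
by apply: (nondecreasing_ge0_comp_measurable (energy_le Hf)).
Qed.

Let df_comp_measurable (u : T -> R) : measurable_fun Om u -> (forall x, Om x -> 0 <= u x) ->
  measurable_fun Om (df \o u).
Proof. by move=> um u0; apply: (nondecreasing_ge0_comp_measurable (energy_derive_le Hf)). Qed.

Section Minimizer.
Context {mu nu : probability T R} {u : T -> R}.
Hypotheses (nuOm : nu Om = 1%E) (hu : has_density m Om mu u).
Hypothesis mu_min : forall P (r : T -> R), has_density m Om P r ->
  (cost_to mu nu + energy u <= cost_to P nu + energy r)%E.

Let u_measurable : measurable_fun Om u. Proof. by case: hu. Qed.
Let u0 x : Om x -> 0 <= u x. Proof. by case: hu => _ [+ _]; exact. Qed.

Lemma minimizer_energy_fin : energy u \is a fin_num.
Proof.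
have muOm := has_density_domain mO hu; have [P hP] := uniform_probability mO mOm_gt0 mOm_fin.
have POm := has_density_domain mO hP.
rewrite ge0_fin_numE; last by apply: integral_ge0 => x Ox; rewrite lee_fin (energy_ge0 Hf) ?u0.
have := mu_min hP; rewrite {2}/internal_energy integral_cst// mOmE.
rewrite -(fineK (transport_cost_fin Hts POm nuOm)) -(fineK (transport_cost_fin Hts muOm nuOm)).
by case: (energy u) => [r| |]//=; rewrite ltry.
Qed.

Section Direction.
Context {rho : probability T R} {r : T -> R} {M b : R}.
Hypothesis hr : has_density m Om rho r.
Hypotheses (M0 : 0 <= M) (b0 : 0 <= b).
Hypotheses (r_le : forall x, Om x -> r x <= M) (w_le : forall x, Om x -> r x != 0 -> df (u x) <= b).

Let mr : measurable_fun Om r. Proof. by case: hr. Qed.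
Let r0 x : Om x -> 0 <= r x. Proof. by case: hr => _ [+ _]; exact. Qed.

Let mix e x := (1 - e) * u x + e * r x.
Let K := (b + df M) * M.
Let slack e x := df (mix e x) * (u x - r x) + K.

Let mix_ge0 e x : 0 <= e <= 1 -> Om x -> 0 <= mix e x.
Proof. by move=> /andP[e0 e1] Ox; rewrite addr_ge0 ?mulr_ge0 ?subr_ge0 ?u0 ?r0. Qed.

Let mix_measurable e : measurable_fun Om (mix e).
Proof. by apply: measurable_funD; apply: measurable_funM. Qed.

Let K_ge0 : 0 <= K. Proof. by rewrite mulr_ge0// addr_ge0// (energy_derive_ge0 Hf). Qed.

Let df_mix_le e x : 0 <= e <= 1 -> Om x -> df (mix e x) * r x <= K.
Proof.
move=> e01 Ox; have [->|rx] := eqVneq (r x) 0; first by rewrite mulr0 K_ge0.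
have [/andP[e0 e1] ux rx0] := And3 e01 (u0 Ox) (r0 Ox).
have dM := energy_derive_ge0 Hf M0; have du := energy_derive_ge0 Hf ux.
rewrite ler_pM ?r_le ?(energy_derive_ge0 Hf) ?mix_ge0//.
apply: (@le_trans _ _ (df (Num.max (u x) M))).
  apply: (energy_derive_le Hf); rewrite ?nnegrE ?mix_ge0 ?le_max ?ux//.
  have := r_le Ox; rewrite /mix; case: (leP (u x) M) => ? ?; nra.
by have := w_le Ox rx; case: (leP (u x) M); lra.
Qed.

Let slack_ge0 e x : 0 <= e <= 1 -> Om x -> 0 <= slack e x.
Proof.
move=> e01 Ox; have := df_mix_le e01 Ox.
have : 0 <= df (mix e x) * u x by rewrite mulr_ge0 ?u0// (energy_derive_ge0 Hf) ?mix_ge0.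
by rewrite /slack mulrBr; lra.
Qed.

Let slack_measurable e : 0 <= e <= 1 -> measurable_fun Om (fun x => (slack e x)%:E).
Proof.
move=> e01; apply/measurable_EFinP; apply: measurable_funD => //; apply: measurable_funM.
  by apply: df_comp_measurable => // x; exact: mix_ge0.
exact: measurable_funB.
Qed.

Let energy_mix_le e : 0 <= e <= 1 ->
  (energy (mix e) + e%:E * \int[m]_(x in Om) (slack e x)%:E <=
   energy u + (e * (K * fine (m Om)))%:E)%E.
Proof.
move=> e01; have /andP[e0 e1] := e01.
have -> : ((e * (K * fine (m Om)))%:E = \int[m]_(x in Om) (e * K)%:E)%E.
  by rewrite integral_cst// mulrA EFinM -mOmE.
rewrite -ge0_integralZl_EFin//; last 2 first.
- by move=> x Ox; rewrite lee_fin slack_ge0.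
- exact: slack_measurable.
have mfmix : measurable_fun Om (fun x => (f (mix e x))%:E).
  by apply: f_comp_measurable => // x; exact: mix_ge0.
have mslack : measurable_fun Om (fun x => (e%:E * (slack e x)%:E))%E.
  by apply: measurable_funeM; exact: slack_measurable.
rewrite -!ge0_integralD//; try exact: f_comp_measurable; last 4 first.
- by move=> x Ox; rewrite lee_fin (energy_ge0 Hf) ?u0.
- by move=> x Ox; rewrite lee_fin mulr_ge0.
- by move=> x Ox; rewrite lee_fin (energy_ge0 Hf) ?mix_ge0.
- by move=> x Ox; rewrite -EFinM lee_fin mulr_ge0 ?slack_ge0.
apply: ge0_le_integral => //.
- by move=> x Ox; rewrite adde_ge0// lee_fin ?mulr_ge0 ?slack_ge0 ?(energy_ge0 Hf) ?mix_ge0.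
- exact: emeasurable_funD.
- by apply: emeasurable_funD => //; exact: f_comp_measurable.
move=> x Ox; rewrite -EFinM -!EFinD lee_fin.
have := energy_above_tangent Hf (mix_ge0 e01 Ox) (u0 Ox).
have -> : u x - mix e x = e * (u x - r x) by rewrite /mix; ring.
by rewrite /slack; lra.
Qed.

Let minimizer_slack_le e : 0 < e <= 1 ->
  (cost_to mu nu + \int[m]_(x in Om) (slack e x)%:E <=
   cost_to rho nu + (K * fine (m Om))%:E)%E.
Proof.
move=> /andP[e0 e1]; have e01 : 0 <= e <= 1 by rewrite ltW.
have [muOm rhoOm] := (has_density_domain mO hu, has_density_domain mO hr).
have [P [PE _]] := probability_mixture mu rho e01.
have hP := has_density_mixture mO e01 hu hr PE.
have cost_convex := transport_cost_convex Hts e01 muOm rhoOm nuOm PE.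
have POm := has_density_domain mO hP.
have := mu_min hP; move: cost_convex (energy_mix_le e01).
rewrite -(fineK minimizer_energy_fin) -(fineK (transport_cost_fin Hts muOm nuOm)).
rewrite -(fineK (transport_cost_fin Hts rhoOm nuOm)) -(fineK (transport_cost_fin Hts POm nuOm)).
have : (0 <= \int[m]_(x in Om) (slack e x)%:E)%E.
  by apply: integral_ge0 => x Ox; rewrite lee_fin slack_ge0.
have : (0 <= energy (mix e))%E.
  by apply: integral_ge0 => x Ox; rewrite lee_fin (energy_ge0 Hf) ?mix_ge0.
move: (\int[m]_(x in Om) _)%E (energy (mix e)) => S I.
case: I => [i| |]//; case: S => [s| |]// _ _; try by move=> _; rewrite gt0_muley ?lte_fin.
rewrite -!EFinD !lee_fin => convex tangent minimal.
by rewrite -(ler_pM2l e0); lra.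
Qed.

(* Fatou's lemma along [e = 1/(n+1)]: only the lower bound [slack_ge0] is uniform in [e]. *)
Let minimizer_slack0_le :
  (cost_to mu nu + \int[m]_(x in Om) (slack 0 x)%:E <=
   cost_to rho nu + (K * fine (m Om))%:E)%E.
Proof.
pose e n : R := n.+1%:R^-1.
have e01 n : 0 < e n <= 1 by rewrite invr_gt0 ltr0n/= invf_le1// ler1n.
have e01' n : 0 <= e n <= 1 by have /andP[e0 ->] := e01 n; rewrite ltW.
have Tm := transport_cost_fin Hts (has_density_domain mO hu) nuOm.
rewrite addeC -leeBrDr//.
apply: (@fatou_le _ _ _ _ _ (fun n x => (slack (e n) x)%:E)) => //.
- by move=> n; exact: slack_measurable.
- by move=> n x Ox; rewrite lee_fin slack_ge0.
- move=> x Ox; apply: cvg_EFin; first exact: nearW.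
  apply: cvgD; last exact: cvg_cst.
  apply: cvgMl; apply: (energy_derive_cvg Hf).
  + by apply: mix_ge0 => //; rewrite lexx ler01.
  + by move=> n; exact: mix_ge0.
  have e_cvg : e @ \oo --> (0 : R) by exact: cvg_harmonic.
  apply: cvgD; apply: cvgMl => //.
  by apply: cvgB => //; exact: cvg_cst.
- by move=> n; rewrite leeBrDr// addeC minimizer_slack_le.
Qed.

Lemma first_order_optimality :
  (cost_to mu nu + \int[mu]_(x in Om) (df (u x))%:E <=
   cost_to rho nu + \int[rho]_(x in Om) (df (u x))%:E)%E.
Proof.
have mw : measurable_fun Om (fun x => (df (u x))%:E).
  by apply/measurable_EFinP; exact: df_comp_measurable.
have w0 x : Om x -> (0 <= (df (u x))%:E)%E.
  by move=> Ox; rewrite lee_fin (energy_derive_ge0 Hf) ?u0.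
rewrite (has_density_integral mO hu mw w0) (has_density_integral mO hr mw w0).
have slack0E x : Om x -> ((df (u x))%:E * (u x)%:E + K%:E =
    (slack 0 x)%:E + (df (u x))%:E * (r x)%:E)%E.
  by move=> Ox; rewrite -!EFinM -!EFinD /slack /mix subr0 mul1r mul0r addr0; congr EFin; ring.
have mwr (k : T -> R) : measurable_fun Om k ->
    measurable_fun Om (fun x => (df (u x))%:E * (k x)%:E)%E.
  by move=> mk; apply: emeasurable_funM => //; exact/measurable_EFinP.
have e01 : 0 <= (0 : R) <= 1 by rewrite lexx ler01.
have split_slack : (\int[m]_(x in Om) ((df (u x))%:E * (u x)%:E) + (K * fine (m Om))%:E =
    \int[m]_(x in Om) (slack 0 x)%:E + \int[m]_(x in Om) ((df (u x))%:E * (r x)%:E))%E.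
  have -> : ((K * fine (m Om))%:E = \int[m]_(x in Om) K%:E)%E.
    by rewrite integral_cst// EFinM -mOmE.
  rewrite -!ge0_integralD//; try exact: mwr; try exact: slack_measurable.
  - by apply: eq_integral => x /set_mem; exact: slack0E.
  - by move=> x Ox; rewrite lee_fin slack_ge0.
  - by move=> x Ox; rewrite mule_ge0 ?w0// lee_fin r0.
  - by move=> x Ox; rewrite mule_ge0 ?w0// lee_fin u0.
have KmF : (K * fine (m Om))%:E \is a fin_num by [].
rewrite -(leeD2rE _ _ KmF) -addeA split_slack addeA [leRHS]addeAC.
exact: leeD minimizer_slack0_le (lexx _).
Qed.

End Direction.
End Minimizer.
End FirstVariation.

(** * Attainment of the dual problem *)

Section EssentialTransform.
Context {d : measure_display} {T : measurableType d} {R : realType}.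
Context (m : {measure set T -> \bar R}) (Om : set T) (c : T -> T -> R).
Hypotheses (Hts : transport_space Om c) (mOm_gt0 : (0 < m Om)%E).
Implicit Types (h : T -> R) (x y : T).
Local Notation ct := (ctransform Om c).

Let mO : measurable Om. Proof. exact: transport_domain_measurable Hts. Qed.

(* The c-transform with the infimum over [Om] taken up to [m]-null sets. *)
Definition ess_ctransform h y : R :=
  fine (ess_inf m (patch (fun=> +oo%E) Om (fun x => (c x y - h x)%:E))).

Definition bounded_above_on h : Prop := exists M : R, forall x, Om x -> h x <= M.

Lemma ess_ctransformP h y (t : R) : bounded_above_on h ->
  t <= ess_ctransform h y <-> {ae m, forall x, Om x -> t <= c x y - h x}.
Proof.
move=> [M hM]; rewrite /ess_ctransform; set k := patch _ _ _.
have ae_k (s : R) : (s%:E <= ess_inf m k)%E <-> {ae m, forall x, Om x -> s <= c x y - h x}.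
  split=> [/ess_infP|] ae_s; last apply/ess_infP; apply: filterS ae_s => x.
    by move=> + Ox; rewrite /k /patch mem_set// lee_fin.
  by move=> sx; rewrite /k /patch; case: ifPn => [/set_mem/sx|_]; rewrite ?leey.
have k_ge : ((- M)%:E <= ess_inf m k)%E.
  by apply/ae_k; apply: aeW => x Ox; have := hM x Ox; have := cost_ge0 Hts x y; lra.
have k_lty : (ess_inf m k < +oo)%E.
  rewrite ltey; apply/eqP => /ess_inf_eqyP k_infty; move: mOm_gt0.
  suff -> : m Om = 0%E by rewrite ltxx.
  apply: (negligibleP m mO).1; apply: negligibleS k_infty => x Ox /=.
  by rewrite /k /patch mem_set.
by rewrite -ae_k -lee_fin fineK// fin_real// k_lty andbT (lt_le_trans _ k_ge)// ltNyr.
Qed.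

Lemma ess_ctransform_lipschitz h : bounded_above_on h -> cost_lipschitz Om c (ess_ctransform h).
Proof.
move=> bh; apply: cost_lipschitz_le => x x' e Ox Ox' xx'; rewrite -lerBlDr.
apply/ess_ctransformP => //.
have := (ess_ctransformP x _ bh).1 (lexx (ess_ctransform h x)); apply: filterS => y hy Oy.
by have := hy Oy; have := xx' y Oy; rewrite !(cost_sym Hts _ y); lra.
Qed.

Lemma ess_ctransform_ge0 h y : (forall x, Om x -> h x <= 0) -> 0 <= ess_ctransform h y.
Proof.
move=> h0; apply/ess_ctransformP; first by exists 0.
by apply: aeW => x Ox; rewrite subr_ge0 (le_trans (h0 x Ox)) ?(cost_ge0 Hts).
Qed.

Definition contact_set h (e : R) y : set T :=
  Om `&` (fun x => c x y - h x) @^-1` `]-oo, ess_ctransform h y + e[.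

Lemma contact_setP h e y x :
  contact_set h e y x <-> Om x /\ c x y - h x < ess_ctransform h y + e.
Proof. by rewrite /contact_set /= in_itv. Qed.

Lemma contact_set_measurable h e y : measurable_fun Om h -> measurable (contact_set h e y).
Proof.
move=> mh; have mcy : measurable_fun Om (c^~ y).
  by apply: measurable_funTS; exact: (measurable_fun_pair1 y (transport_cost_measurable Hts)).
by apply: measurable_funB.
Qed.

Lemma contact_set_gt0 h e y : bounded_above_on h -> measurable_fun Om h -> 0 < e ->
  (0 < m (contact_set h e y))%E.
Proof.
move=> bh mh e0; rewrite lt_neqAle measure_ge0 andbT eq_sym; apply/eqP => null.
suff : ess_ctransform h y + e <= ess_ctransform h y by lra.
apply/ess_ctransformP => //.
apply: filterS (ae_notin (contact_set_measurable e y mh) null) => x nE Ox.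
by rewrite leNgt; apply/negP => lt; apply: nE; apply/contact_setP.
Qed.

Lemma ae_le_ctransform_ess h : bounded_above_on h ->
  {ae m, forall x, Om x -> h x <= ct (ess_ctransform h) x}.
Proof.
move=> bh; have lg := ess_ctransform_lipschitz bh; set g := ess_ctransform h in lg *.
have ae_eps (e : R) : 0 < e ->
    {ae m, forall x, Om x -> forall y, Om y -> g y <= c x y - h x + e}.
  move=> e0; have e2 : 0 < e / 2 by rewrite divr_gt0.
  have [I [k [r [_ Or kr]]]] := transport_net Hts e2.
  have : {ae m, forall x, forall i, Om x -> g (r i) <= c x (r i) - h x}.
    by apply: filter_forall => i; apply/ess_ctransformP.
  apply: filterS => x gr Ox y Oy; have := gr (k y) Ox.
  have := lg y (r (k y)) (e / 2) Oy (Or _) (kr y ^~ Oy).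
  have := kr y x Oy Ox; rewrite !(cost_sym Hts _ x) !ler_norml.
  by move=> /andP[? ?] /andP[? ?] ?; lra.
have : {ae m, forall x, forall n : nat, Om x -> forall y, Om y -> g y <= c x y - h x + n.+1%:R^-1}.
  by apply: ae_foralln => n; apply: ae_eps; rewrite invr_gt0.
apply: filterS => x gx Ox; apply: (le_ctransform Hts) => y Oy.
suff : g y <= c x y - h x by rewrite (cost_sym Hts y); lra.
apply/ler_addgt0Pr => e e0; have [n ne] := ltr_add_invr e0.
rewrite add0r in ne; by apply: le_trans (gx n Ox y Oy) _; rewrite lerD2l ltW.
Qed.

End EssentialTransform.

Section CellwiseCoupling.
Context {d : measure_display} {T : measurableType d} {R : realType}.
Context (m : {measure set T -> \bar R}) (Om : set T) (nu : probability T R).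
Context {I : finType} (k : T -> I) (A : I -> set T).
Hypotheses (mO : measurable Om) (mOm_gt0 : (0 < m Om)%E) (mOm_fin : (m Om < +oo)%E).
Hypotheses (mk : measurable_fibers k) (mA : forall i, measurable (A i)).
Hypotheses (AOm : forall i, A i `<=` Om) (mA_gt0 : forall i, (0 < m (A i))%E).
Hypothesis nuOm : nu Om = 1%E.

(* Mass of [nu] at [y] is spread uniformly over [A (k y)]. *)
Let spread (P : probability T R) (z : T * T) : R :=
  \1_(A (k z.2)) z.1 / fine (P (A (k z.2))).

Let spreadE P z : spread P z =
  \sum_i \1_(A i) z.1 / fine (P (A i)) * \1_(k @^-1` [set i]) z.2.
Proof.
rewrite (bigD1 (k z.2))//= big1 ?addr0 => [|i ik].
  by rewrite [X in _ * X]indicE mem_set// mulr1.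
by rewrite [X in _ * X]indicE memNset ?mulr0//= => ki; rewrite ki eqxx in ik.
Qed.

Let spread_measurable P : measurable_fun setT (fun z => (spread P z)%:E).
Proof.
apply/measurable_EFinP; rewrite (_ : spread P = fun z => \sum_i \1_(A i) z.1 / fine (P (A i)) *
    \1_(k @^-1` [set i]) z.2); last by apply/funext => z; exact: spreadE.
apply: measurable_sum => i; apply: measurable_funM; first apply: measurable_funM => //.
  exact: (measurableT_comp (measurable_indic (mA i)) measurable_fst).
exact: (measurableT_comp (measurable_indic (mk i)) measurable_snd).
Qed.

Let spread_ge0 P z : (0 <= (spread P z)%:E)%E.
Proof. by rewrite lee_fin divr_ge0// fine_ge0. Qed.

Let marginal (P : probability T R) x : R :=
  \sum_i \1_(A i) x / fine (P (A i)) * fine (nu (k @^-1` [set i])).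

Let spread_snd P x : (\int[nu]_y (spread P (x, y))%:E = (marginal P x)%:E)%E.
Proof.
under eq_integral do rewrite spreadE -sumEFin.
rewrite ge0_integral_sum//; last 2 first.
- move=> i; apply/measurable_EFinP; apply: measurable_funM => //=.
  exact: measurable_indic (mk i).
- by move=> i y _; rewrite lee_fin mulr_ge0// divr_ge0// fine_ge0.
rewrite -sumEFin; apply: eq_bigr => i _; under eq_integral do rewrite EFinM.
rewrite /= ge0_integralZl_EFin//; last 2 first.
- apply/measurable_EFinP; exact: measurable_indic (mk i).
- by rewrite divr_ge0// fine_ge0.
by rewrite integral_indic// setIT [RHS]EFinM fineK// fin_num_measure.
Qed.

Let spread_fst (P : probability T R) y : 0 < fine (P (A (k y))) ->
  (\int[P]_x (spread P (x, y))%:E = 1)%E.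
Proof.
move=> PAy; under eq_integral do rewrite /spread/= EFinM.
rewrite ge0_integralZr//= ?lee_fin ?invr_ge0 ?ltW//; last first.
  by apply/measurable_EFinP; exact: measurable_indic.
rewrite integral_indic// setIT -[X in (X * _)%E]fineK ?fin_num_measure// -EFinM.
by rewrite divff// (gt_eqF PAy).
Qed.

Let marginal_ge0 P x : 0 <= marginal P x.
Proof. by apply: sumr_ge0 => i _; rewrite mulr_ge0 ?divr_ge0 ?fine_ge0. Qed.

Let marginal_le P x : marginal P x <= \sum_i (fine (P (A i)))^-1.
Proof.
apply: ler_sum => i _; rewrite -[leRHS]mulr1.
have nu1 : fine (nu (k @^-1` [set i])) <= 1.
  by rewrite -lee_fin fineK ?fin_num_measure//; exact: probability_le1.
rewrite ler_pM ?divr_ge0 ?fine_ge0// ler_piMl ?invr_ge0 ?fine_ge0//.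
Qed.

Let marginal_neq0 P x : marginal P x != 0 -> exists i, A i x.
Proof.
apply: contraNP => nA; rewrite /marginal big1// => i _.
by rewrite indicE memNset ?mul0r// => Ax; apply: nA; exists i.
Qed.

Let marginal_measurable P D : measurable_fun D (marginal P).
Proof.
apply: measurable_sum => i; apply: measurable_funM => //; apply: measurable_funM => //.
Qed.

Let marginal_integral (P : probability T R) (a : R) (B : set T) : measurable B ->
  has_density m Om P (fun=> a) ->
  (\int[P]_(x in B) (marginal P x)%:E = \int[m]_(x in B `&` Om) (marginal P x * a)%:E)%E.
Proof.
move=> mB hP; have marginalE : (fun x => (marginal P x)%:E) \_ B =
    ((fun x => (marginal P x)%:E) \_ B) \_ Om.
  apply/funext => x; rewrite [RHS]patchE; case: ifPn => // nOx; rewrite patchE; case: ifP => // _.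
  apply/eqP; rewrite eqe; apply: contraT => /marginal_neq0[i /AOm Ox].
  by rewrite mem_set in nOx.
rewrite [LHS]integral_mkcond.
rewrite marginalE -integral_mkcond (has_density_integral mO hP); last 2 first.
- apply: measurable_funTS; apply/(measurable_restrictT _ mB); apply/measurable_EFinP.
  exact: marginal_measurable.
- by move=> x _; rewrite patchE; case: ifP; rewrite // lee_fin marginal_ge0.
rewrite setIC integral_mkcondr; apply: eq_integral => x _; rewrite !patchE.
by case: ifP; rewrite ?mul0e.
Qed.

Lemma cellwise_coupling : exists (rho : probability T R) r (M : R) S,
  [/\ has_density m Om rho r, (forall x, 0 <= r x <= M),
   (forall x, r x != 0 -> exists i, A i x), is_plan Om rho nu S &
   {ae S, forall z, A (k z.2) z.1}].
Proof.
have [P hP] := uniform_probability mO mOm_gt0 mOm_fin; set a := (fine (m Om))^-1 in hP *.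
have a0 : 0 < a by rewrite invr_gt0 fine_gt0// mOm_gt0.
have PA_gt0 i : 0 < fine (P (A i)).
  rewrite fine_gt0// (le_lt_trans (probability_le1 _ (mA i)) (ltry _)) andbT.
  have [_ [_ ->//]] := hP; rewrite setIidl//.
  by rewrite integral_cst// mule_gt0// lte_fin.
have spread1 y := spread_fst (PA_gt0 (k y)).
have [S [SE Smarg]] := density_coupling nu (spread_measurable P) (spread_ge0 P) spread1.
have Sfst B : measurable B -> S (B `*` setT) = (\int[m]_(x in B `&` Om) (marginal P x * a)%:E)%E.
  move=> mB; rewrite (Smarg B mB).1 -marginal_integral//.
  by apply: eq_integral => x _; exact: spread_snd.
have [||| rho hrho] := @has_density_exists _ _ _ m Om (fun x => marginal P x * a) mO.
- by apply: measurable_funM => //; exact: marginal_measurable.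
- by move=> x _; rewrite mulr_ge0// ltW.
- by rewrite -[X in integral _ X _]setTI -Sfst// setXTT probability_setT.
exists rho, (fun x => marginal P x * a), ((\sum_i (fine (P (A i)))^-1) * a), S; split=> //.
- move=> x; have aW := ltW a0; rewrite mulr_ge0//=.
  by apply: ler_wpM2r (marginal_le P x).
- by move=> x; rewrite mulf_eq0 negb_or => /andP[/marginal_neq0].
- have SrhoE B : measurable B -> S (B `*` setT) = rho B.
    by move=> mB; rewrite Sfst//; have [_ [_ ->]] := hrho.
  split=> [|B mB]; last by rewrite SrhoE// (Smarg B mB).2.
  have -> : Om `*` Om = (Om `*` setT) `&` (setT `*` Om) by rewrite -setXI setIT setTI.
  apply: probability_setI1; first exact: measurableX.
  + exact: measurableX.
  + by rewrite SrhoE// (has_density_domain mO hrho).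
  + by rewrite (Smarg Om mO).2.
have mE : measurable (spread P @^-1` [set 0]).
  have /measurable_EFinP ms := spread_measurable P.
  by rewrite -[X in measurable X]setTI; exact: ms.
apply: filterS (ae_notin mE _) => [z /= spread_neq0|].
  apply: contrapT => nA; apply: spread_neq0.
  by rewrite /spread indicE memNset ?mul0r.
by apply: etrans (SE _) _; rewrite integral0_eq// => z /= ->.
Qed.

End CellwiseCoupling.

Section DualAttainment.
Context {d : measure_display} {T : measurableType d} {R : realType}.
Context {Om : set T} {c : T -> T -> R} {m : {measure set T -> \bar R}} {nu : probability T R}.
Hypothesis Hts : transport_space Om c.
Hypotheses (mOm_gt0 : (0 < m Om)%E) (mOm_fin : (m Om < +oo)%E) (nuOm : nu Om = 1%E).
Implicit Types (P : probability T R) (x y : T).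
Local Notation cost_to := (transport_cost Om c).
Local Notation ct := (ctransform Om c).

Let mO : measurable Om. Proof. exact: transport_domain_measurable Hts. Qed.

Let measurable_cost : measurable_fun setT (fun z : T * T => (c z.1 z.2)%:E).
Proof. by apply/measurable_EFinP; exact: transport_cost_measurable Hts. Qed.

Section ContactPlan.
Context {w : T -> R}.
Hypotheses (mw : measurable_fun Om w) (w0 : forall x, Om x -> 0 <= w x).
Local Notation g := (ess_ctransform m Om c (fun x => - w x)).

Let w_bounded : bounded_above_on Om (fun x => - w x).
Proof. by exists 0 => x Ox; rewrite oppr_le0 w0. Qed.

Let g_lipschitz : cost_lipschitz Om c g.
Proof. exact: ess_ctransform_lipschitz. Qed.

Let g_ge0 y : 0 <= g y.
Proof. by apply: ess_ctransform_ge0 => // x Ox; rewrite oppr_le0 w0. Qed.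

Lemma exists_contact_plan (e : R) : 0 < e -> exists (rho : probability T R) r (M b : R) S,
  [/\ has_density m Om rho r, (forall x, 0 <= r x <= M),
   (forall x, r x != 0 -> w x <= b), is_plan Om rho nu S &
   {ae S, forall z, c z.1 z.2 + w z.1 <= g z.2 + e}].
Proof.
move=> e0; have t0 : 0 < e / 3 by rewrite divr_gt0.
have [I [k [y_ [mk Oy_ ky]]]] := transport_net Hts t0.
pose A i := contact_set m Om c (fun x => - w x) (e / 3) (y_ i).
have AP i x : A i x <-> Om x /\ c x (y_ i) + w x < g (y_ i) + e / 3.
  by rewrite -[w x]opprK; exact: contact_setP.
have mNw : measurable_fun Om (fun x => - w x) by exact: measurableT_comp.
have mA i : measurable (A i) by exact: contact_set_measurable.
have A_gt0 i : (0 < m (A i))%E by exact: contact_set_gt0.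
have AOm i : A i `<=` Om by move=> x /AP[].
have [rho [r [M [S [hr rM rA planS S_A]]]]] :=
  cellwise_coupling mO mOm_gt0 mOm_fin mk mA AOm A_gt0 nuOm.
have [G gG] := cost_lipschitz_bounded Hts g_lipschitz.
exists rho, r, M, (G + e / 3), S; split=> //.
  move=> x /rA[i /AP[Ox wx]]; have := cost_ge0 Hts x (y_ i).
  by have := gG _ (Oy_ i); rewrite ler_norml => /andP[_ ?]; lra.
apply: filterS2 (plan_ae Hts planS) S_A => -[x y] /= [Ox Oy] /AP[_ xy].
have := g_lipschitz (e := e / 3) Oy (Oy_ (k y)) (ky y ^~ Oy).
have := ky y x Oy Ox; rewrite !(cost_sym Hts _ x) !ler_norml.
by move=> /andP[? ?] /andP[? ?]; lra.
Qed.

Lemma contact_plan_cost_le (rho : probability T R) S (e : R) : is_plan Om rho nu S ->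
  {ae S, forall z, c z.1 z.2 + w z.1 <= g z.2 + e} -> 0 <= e ->
  (cost_to rho nu + \int[rho]_(x in Om) (w x)%:E <= (\int[nu]_(y in Om) g y + e)%:E)%E.
Proof.
move=> planS contact e0; pose w_Om : T -> \bar R := (EFin \o w) \_ Om.
have mwOm : measurable_fun setT w_Om.
  by apply/(measurable_restrictT _ mO); exact/measurable_EFinP.
have w_Om0 x : (0 <= w_Om x)%E.
  by rewrite /w_Om patchE; case: ifPn => // /set_mem; rewrite lee_fin; exact: w0.
have mgOm : measurable_fun setT (shifted Om g 0) by exact: (shifted_measurable Hts).
have g_Om0 y : (0 <= shifted Om g 0 y)%E by apply: shifted_ge0 => z _; rewrite oppr0.
have c0 x y : (0 <= (c x y)%:E)%E by rewrite lee_fin (cost_ge0 Hts).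
apply: (@le_trans _ _ (\int[S]_z ((c z.1 z.2)%:E + w_Om z.1))%E).
  rewrite ge0_integralD//; last exact: (measurableT_comp mwOm measurable_fst).
  by rewrite (plan_integral_fst planS)// -integral_mkcond leeD2r// (transport_cost_le c planS).
apply: (@le_trans _ _ (\int[S]_z (shifted Om g 0 z.2 + e%:E))%E); last first.
  rewrite ge0_integralD//; last exact: (measurableT_comp mgOm measurable_snd).
  rewrite (plan_integral_snd planS)// (shifted_integral Hts)// integral_cst//=.
  by rewrite probability_setT mule1 addr0 EFinD.
apply: ae_ge0_le_integral => //.
- by move=> z _; rewrite adde_ge0.
- by apply: emeasurable_funD => //; exact: (measurableT_comp mwOm measurable_fst).
- by move=> z _; rewrite adde_ge0.
- by apply: emeasurable_funD => //; exact: (measurableT_comp mgOm measurable_snd).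
apply: filterS2 (plan_ae Hts planS) contact => -[x y] /= [Ox Oy] xy _.
by rewrite /w_Om /shifted !patchE !mem_set// -!EFinD lee_fin addr0.
Qed.

End ContactPlan.

Section MinimizerPotential.
Context {f df : R -> R} {mu : probability T R} {u : T -> R}.
Hypotheses (Hf : convex_energy f df) (cost_diag : forall x, c x x = 0).
Hypothesis hu : has_density m Om mu u.
Hypothesis mu_min : forall P (r : T -> R), has_density m Om P r ->
  (cost_to mu nu + internal_energy m Om f u <= cost_to P nu + internal_energy m Om f r)%E.

Let u0 x : Om x -> 0 <= u x. Proof. by case: hu => _ [+ _]; exact. Qed.

Local Notation w := (df \o u).
Local Notation g := (ess_ctransform m Om c (fun x => - w x)).

Let mw : measurable_fun Om w.
Proof.
by have [mu_ _] := hu; apply: (nondecreasing_ge0_comp_measurable (energy_derive_le Hf)).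
Qed.

Let w0 x : Om x -> 0 <= w x. Proof. by move=> /u0/(energy_derive_ge0 Hf). Qed.

Lemma minimizer_dual_bound :
  (cost_to mu nu + \int[mu]_(x in Om) (w x)%:E <= (\int[nu]_(y in Om) g y)%:E)%E.
Proof.
apply/lee_addgt0Pr => e e0.
have [rho [r [M [b [S [hr rM wb planS contact]]]]]] := exists_contact_plan mw w0 e0.
apply: le_trans (contact_plan_cost_le mw w0 planS contact (ltW e0)).
have M0 : 0 <= M by have [x Ox] := cost_domain_neq0 Hts; have /andP[] := rM x; exact: le_trans.
apply: (first_order_optimality Hts Hf mOm_gt0 mOm_fin nuOm hu mu_min hr M0 (b := Num.max b 0)).
- by rewrite le_max lexx orbT.
- by move=> x _; have /andP[] := rM x.
- by move=> x _ /wb wx; rewrite le_max wx.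
Qed.

Local Notation phi := (ct g).

Let Nw_bounded : bounded_above_on Om (fun x => - w x).
Proof. by exists 0 => x Ox; rewrite oppr_le0 w0. Qed.

Let g_lipschitz : cost_lipschitz Om c g.
Proof. exact: ess_ctransform_lipschitz. Qed.

Let g_bounded : bounded_on Om g.
Proof. exact: (cost_lipschitz_bounded Hts). Qed.

Let phi_lipschitz : cost_lipschitz Om c phi.
Proof. exact: (ctransform_lipschitz Hts). Qed.

Let phi_bounded : bounded_on Om phi.
Proof. exact: (cost_lipschitz_bounded Hts). Qed.

Let w_integrable : mu.-integrable Om (EFin \o w).
Proof.
apply/integrableP; split; first exact/measurable_EFinP.
under eq_integral => x /set_mem Ox do rewrite /= ger0_norm ?w0//.
apply: le_lt_trans (ltry (\int[nu]_(y in Om) g y)); apply: le_trans minimizer_dual_bound.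
by rewrite leeDr// transport_cost_ge0.
Qed.

Let phi_integrable : mu.-integrable Om (EFin \o phi).
Proof. exact: (cost_lipschitz_integrable Hts). Qed.

Let w_phi_integrable : mu.-integrable Om (EFin \o (fun x => w x + phi x)).
Proof. exact: (integrableD mO w_integrable phi_integrable). Qed.

Let phi_le0 x : Om x -> phi x <= 0.
Proof.
move=> Ox; apply: le_trans (ctransform_le Hts x g_bounded Ox) _.
by rewrite cost_diag sub0r oppr_le0 ess_ctransform_ge0// => y Oy; rewrite oppr_le0 w0.
Qed.

Let w_phi_ge0 : {ae m, forall x, Om x -> 0 <= w x + phi x}.
Proof.
apply: filterS (ae_le_ctransform_ess Hts mOm_gt0 Nw_bounded) => x + Ox => /(_ Ox).
by rewrite -lerBlDl sub0r.
Qed.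

Let cost_w_le_dual :
  fine (cost_to mu nu) + \int[mu]_(x in Om) (w x + phi x) <= dual_value Om c mu nu phi.
Proof.
have muOm := has_density_domain mO hu.
have : fine (cost_to mu nu) + \int[mu]_(x in Om) w x <= \int[nu]_(y in Om) g y.
  rewrite -lee_fin EFinD fineK ?(transport_cost_fin Hts)// fineK ?integrable_fin_num//.
  exact: minimizer_dual_bound.
have : \int[nu]_(y in Om) g y <= \int[nu]_(y in Om) ct phi y.
  apply: le_Rintegral => //; try exact: (cost_lipschitz_integrable Hts).
    exact/(cost_lipschitz_integrable Hts)/(ctransform_lipschitz Hts).
  by move=> y Oy; exact: (le_ctransformK Hts).
by rewrite RintegralD// /dual_value; lra.
Qed.

Let dual_le_cost h : cost_lipschitz Om c h -> dual_value Om c mu nu h <= fine (cost_to mu nu).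
Proof.
have muOm := has_density_domain mO hu => lh.
by rewrite -lee_fin fineK ?(transport_cost_fin Hts)// (weak_duality Hts).
Qed.

Let w_phi_eq0 : {ae mu, forall x, Om x -> w x + phi x = 0}.
Proof.
apply: ae_ge0_Rintegral_eq0 => //; first exact: (has_density_ae mO hu w_phi_ge0).
by have := dual_le_cost phi_lipschitz; move: cost_w_le_dual; lra.
Qed.

Lemma minimizer_potential : exists phi : T -> R,
  [/\ dual_maximizer Om c mu nu phi, (forall x, Om x -> phi x <= 0) &
   {ae m, forall x, Om x -> df (u x) = - phi x}].
Proof.
exists phi; split=> //.
  split=> [|h /dual_le_cost h_le]; first exact: (ctransform_cconcave Hts).
  have := cost_w_le_dual; suff : 0 <= \int[mu]_(x in Om) (w x + phi x) by lra.
  rewrite -lee_fin -ae_ge0_integral_norm//; first exact: integral_ge0.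
  exact: (has_density_ae mO hu w_phi_ge0).
apply: filterS2 w_phi_ge0 (ae_has_density mO hu w_phi_eq0) => x w_ge w_eq Ox.
have [ux|] := ltP 0 (u x); first by have := w_eq Ox ux => /=; lra.
move=> ux; have {ux} ux0 : u x = 0 by apply: le_anti; rewrite ux u0.
by have := w_ge Ox; have := phi_le0 Ox; rewrite /= ux0 (energy_derive_0 Hf); lra.
Qed.

End MinimizerPotential.
End DualAttainment.

(** * Uniqueness of dual maximizers *)

Definition charges_cost_balls {d : measure_display} {T : measurableType d} {R : realType}
    (Om : set T) (c : T -> T -> R) (nu : {measure set T -> \bar R}) : Prop :=
  forall y (e : R), Om y -> 0 < e -> exists B, [/\ measurable B, (0 < nu B)%E &
    forall z, B z -> Om z /\ forall x, Om x -> `|c y x - c z x| <= e].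

Definition approx_supergradient {R : realType} {X Y : Type} (C : X -> Y -> R) (a : Y -> R)
  (s : R) (y : Y) (x : X) : Prop := forall z, a z - a y <= C x z - C x y + s.

Section MaximizerMidpoint.
Context {d : measure_display} {T : measurableType d} {R : realType}.
Context {Om : set T} {c : T -> T -> R} {mu nu : probability T R} {phi psi : T -> R}.
Hypothesis Hts : transport_space Om c.
Hypothesis nu_charges : charges_cost_balls Om c nu.
Hypotheses (phi_max : dual_maximizer Om c mu nu phi) (psi_max : dual_maximizer Om c mu nu psi).
Implicit Types (x y z : T).
Local Notation ct := (ctransform Om c).

Let mO : measurable Om. Proof. exact: transport_domain_measurable Hts. Qed.

Let phi_lipschitz : cost_lipschitz Om c phi.
Proof. by case: phi_max => /(cconcave_lipschitz Hts). Qed.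

Let psi_lipschitz : cost_lipschitz Om c psi.
Proof. by case: psi_max => /(cconcave_lipschitz Hts). Qed.

Let mid x : R := 2^-1 * phi x + 2^-1 * psi x.

Let mid_lipschitz : cost_lipschitz Om c mid.
Proof. by apply: cost_lipschitz_conv => //; lra. Qed.

Let bounded := cost_lipschitz_bounded Hts.
Let lipschitz_ct h (lh : cost_lipschitz Om c h) := ctransform_lipschitz Hts (bounded lh).

Let gap y : R := ct mid y - (2^-1 * ct phi y + 2^-1 * ct psi y).

Let gap_ge0 y : Om y -> 0 <= gap y.
Proof.
move=> Oy; rewrite subr_ge0; apply: (le_ctransform Hts) => x Ox.
have := ctransform_le Hts y (bounded phi_lipschitz) Ox.
by have := ctransform_le Hts y (bounded psi_lipschitz) Ox; rewrite /mid; lra.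
Qed.

Let mean_ct_lipschitz : cost_lipschitz Om c (fun y => 2^-1 * ct phi y + 2^-1 * ct psi y).
Proof. by apply: cost_lipschitz_conv; try exact: lipschitz_ct; lra. Qed.

Let gap_integrable : nu.-integrable Om (EFin \o gap).
Proof.
have i1 := cost_lipschitz_integrable Hts nu (lipschitz_ct mid_lipschitz).
exact: integrableB i1 (cost_lipschitz_integrable Hts nu mean_ct_lipschitz).
Qed.

Let Rintegral_mean (P : probability T R) h h' : cost_lipschitz Om c h -> cost_lipschitz Om c h' ->
  \int[P]_(x in Om) (2^-1 * h x + 2^-1 * h' x) =
  2^-1 * \int[P]_(x in Om) h x + 2^-1 * \int[P]_(x in Om) h' x.
Proof.
move=> lh lh'; have ih := cost_lipschitz_integrable Hts P lh.
have ih' := cost_lipschitz_integrable Hts P lh'.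
rewrite RintegralD ?RintegralZl//; first exact: (integrableZl mO _ ih).
exact: (integrableZl mO _ ih').
Qed.

Let gap_integral_le0 : \int[nu]_(y in Om) gap y <= 0.
Proof.
have i_mid := cost_lipschitz_integrable Hts nu (lipschitz_ct mid_lipschitz).
have i_mean := cost_lipschitz_integrable Hts nu mean_ct_lipschitz.
rewrite /gap RintegralB// Rintegral_mean; try exact: lipschitz_ct.
have := phi_max.2 mid mid_lipschitz; have := psi_max.2 mid mid_lipschitz.
by rewrite /dual_value !(Rintegral_mean mu)//; lra.
Qed.

Let gap_ae_eq0 : {ae nu, forall y, Om y -> gap y = 0}.
Proof. by apply: ae_ge0_Rintegral_eq0 => //; apply: aeW => y; exact: gap_ge0. Qed.

Lemma dual_maximizers_midpoint y : Om y -> ct mid y = 2^-1 * ct phi y + 2^-1 * ct psi y.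
Proof.
move=> Oy; suff : gap y <= 0 by have := gap_ge0 Oy; rewrite /gap; lra.
apply/ler_addgt0Pr => e e0; rewrite add0r; have e2 : 0 < e / 2 by rewrite divr_gt0.
have [B [mB B_gt0 B_near]] := nu_charges Oy e2.
have [z Bz gapz] : exists2 z, B z & gap z = 0.
  apply: contrapT => no_z; move: B_gt0; rewrite lt_neqAle eq_sym => /andP[/eqP + _]; apply.
  have [N [mN N0 subN]] := gap_ae_eq0; apply: subset_measure0 N0 => // z Bz.
  apply: subN => /= gapz; apply: no_z; exists z => //.
  by apply: gapz; exact: (B_near z Bz).1.
have [Oz yz] := B_near z Bz; rewrite -[leRHS]addr0 -gapz /gap.
have := lipschitz_ct mid_lipschitz Oy Oz yz.
have := mean_ct_lipschitz Oy Oz yz.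
by rewrite !ler_norml => /andP[? ?] /andP[? ?]; lra.
Qed.

Lemma dual_maximizers_supergradient y (s : R) : Om y -> 0 < s -> exists2 x, Om x &
  approx_supergradient c (ct phi) s y x /\ approx_supergradient c (ct psi) s y x.
Proof.
move=> Oy s0; have s2 : 0 < s / 2 by rewrite divr_gt0.
have [x Ox] := ctransform_adherent Hts y (bounded mid_lipschitz) s2.
rewrite dual_maximizers_midpoint// /mid => x_opt; exists x => //.
have phi_y := ctransform_le Hts y (bounded phi_lipschitz) Ox.
have psi_y := ctransform_le Hts y (bounded psi_lipschitz) Ox.
split=> z; first by have := ctransform_le Hts z (bounded phi_lipschitz) Ox; lra.
by have := ctransform_le Hts z (bounded psi_lipschitz) Ox; lra.
Qed.

End MaximizerMidpoint.

(* Summation by parts leaves the second differences of the cost at interior points. *)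
Lemma supergradient_telescope {R : realType} {X Y : Type} (C : X -> Y -> R) (a b : Y -> R)
    (x : nat -> X) (y : nat -> Y) (s : R) (N : nat) :
  (forall j, (j <= N.+1)%N ->
    approx_supergradient C a s (y j) (x j) /\ approx_supergradient C b s (y j) (x j)) ->
  (a (y N.+1) - b (y N.+1)) - (a (y 0%N) - b (y 0%N)) <=
    C (x 0%N) (y 1%N) - C (x 0%N) (y 0%N) + (C (x N.+1) (y N) - C (x N.+1) (y N.+1)) +
    \sum_(j < N) (C (x j.+1) (y j.+2) + C (x j.+1) (y j) - 2 * C (x j.+1) (y j.+1)) +
    2 * s * N.+1%:R.
Proof.
elim: N => [|N IH] super.
  have [/(_ (y 1%N)) a01 _] := super 0%N isT; have [_ /(_ (y 0%N)) b10] := super 1%N isT.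
  by rewrite big_ord0 mulr1; lra.
have [/(_ (y N.+2)) a_next _] := super N.+1 (leqnSn _).
have [_ /(_ (y N.+1)) b_prev] := super N.+2 (leqnn _).
have {IH} := IH (fun j jN => super j (leqW jN)).
by rewrite big_ord_recr/= -[N.+2%:R]natr1; move: (\sum_(j < N) _) => S; lra.
Qed.

Lemma connected_locally_constant {X : topologicalType} {Y : Type} (U : set X) (f : X -> Y) :
  open U -> connected U -> (forall x, U x -> \forall y \near x, f y = f x) ->
  forall x y, U x -> U y -> f x = f y.
Proof.
move=> oU cU f_near x y Ux Uy; pose level := U `&` [set z | f z = f x].
have open_pred (P : X -> Prop) : (forall z z', f z = f z' -> P z -> P z') ->
    open (U `&` [set z | P z]).
  move=> PE; rewrite openE => z [Uz Pz].
  have := open_nbhs_nbhs (conj oU Uz); have := f_near z Uz.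
  by apply: filterS2 => z' fz' Uz'; split=> //; apply: PE Pz.
have levelU : level = U.
  apply: cU; first by exists x.
    exists level; first by apply: open_pred => z z' ->.
    by apply/seteqP; split=> [z [Uz zx]|z []//]; split.
  exists (~` (U `&` [set z | f z <> f x])).
    by rewrite closedC; apply: open_pred => z z' ->.
  apply/seteqP; split=> [z [Uz zx]|z [Uz nz]]; first by split=> // -[].
  by split=> //; apply: contrapT => zx; apply: nz.
by have [_ ->] : level y by rewrite levelU.
Qed.

Section SupergradientRigidity.
Context {R : realType} {n : nat} {p B : R} {U : set 'rV[R]_n} {a b : 'rV[R]_n -> R}.
Hypotheses (p1 : 1 < p) (U_bounded : forall y, U y -> `|y| <= B).
Implicit Types x y z : 'rV[R]_n.
Local Notation C x y := (enorm (x - y) `^ p).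
Local Notation supergradient := (approx_supergradient (fun x y => C x y)).
Hypothesis common_supergradient : forall y (s : R), U y -> 0 < s -> exists2 x, `|x| <= B &
  supergradient a s y x /\ supergradient b s y x.

Let difference_le x y : `|x| <= B -> `|y| <= B -> `|x - y| <= 2 * B.
Proof. by move=> xB yB; apply: le_trans (ler_normB _ _) _; lra. Qed.

Lemma subdivision_difference_le (N : nat) y0 h (e1 e2 : R) :
  (forall j, (j <= N.+1)%N -> U (y0 + j%:R *: h)) ->
  (forall z, `|z| <= 2 * B ->
    enorm (z + h) `^ p + enorm (z - h) `^ p - 2 * enorm z `^ p <= e1) ->
  (forall z, `|z| <= 2 * B -> `|enorm (z + h) `^ p - enorm z `^ p| <= e2 /\
    `|enorm (z - h) `^ p - enorm z `^ p| <= e2) ->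
  (a (y0 + N.+1%:R *: h) - b (y0 + N.+1%:R *: h)) - (a y0 - b y0) <= N%:R * e1 + 2 * e2.
Proof.
move=> yU second_le first_le; apply/ler_addgt0Pr => e e0.
have [y [y00 yN y_step {}yU]] : exists y : nat -> 'rV[R]_n, [/\ y 0%N = y0,
    y N.+1 = y0 + N.+1%:R *: h, (forall j, y j.+1 = y j + h) &
    forall j, (j <= N.+1)%N -> U (y j)].
  exists (fun j => y0 + j%:R *: h); split=> //; first by rewrite scale0r addr0.
  by move=> j; rewrite -natr1 scalerDl scale1r addrA.
pose s := e / (2 * N.+1%:R).
have s0 : 0 < s by rewrite divr_gt0// mulr_gt0.
have sN : 2 * s * N.+1%:R = e by rewrite mulrAC mulrC divfK// mulf_neq0.
have /choice[x x_super] j : exists x, (j <= N.+1)%N -> `|x| <= B /\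
    supergradient a s (y j) x /\ supergradient b s (y j) x.
  have [jN|] := boolP (j <= N.+1)%N; last by exists 0.
  by have [x] := common_supergradient (yU j jN) s0; exists x.
have y_next x' j : x' - y j.+1 = x' - y j - h by rewrite y_step opprD addrA.
have y_prev x' j : x' - y j = x' - y j.+1 + h by rewrite y_step opprD addrA subrK.
have xy_le j : (j <= N.+1)%N -> `|x j - y j| <= 2 * B.
  by move=> jN; apply: difference_le; [have [] := x_super j jN|exact: U_bounded (yU _ jN)].
have start : C (x 0%N) (y 1%N) - C (x 0%N) (y 0%N) <= e2.
  by rewrite y_next (le_trans (ler_norm _))//; case: (first_le _ (xy_le 0%N isT)).
have finish : C (x N.+1) (y N) - C (x N.+1) (y N.+1) <= e2.
  have [/(le_trans (ler_norm _)) + _] := first_le _ (xy_le N.+1 (leqnn _)).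
  by rewrite -(y_prev (x N.+1) N).
have interior : \sum_(j < N) (C (x j.+1) (y j.+2) + C (x j.+1) (y j) - 2 * C (x j.+1) (y j.+1)) <=
    N%:R * e1.
  apply: (@le_trans _ _ (\sum_(j < N) e1)); last by rewrite sumr_const card_ord mulr_natl.
  apply: ler_sum => j _.
  by rewrite y_next (y_prev _ j) [X in X - _]addrC second_le// xy_le// ltnS ltnW.
have := supergradient_telescope (C := fun x y => C x y) (a := a) (b := b) (x := x) (y := y)
  (fun j jN => (x_super j jN).2).
rewrite y00 yN sN in start finish * => telescoped; apply: (le_trans telescoped).
rewrite lerD2r; apply: (le_trans (lerD (lerD start finish) interior)).
by rewrite addrC -mulr2n [2 * e2]mulr_natl.
Qed.

Lemma segment_difference_le y0 y1 :
  (forall t, 0 <= t <= 1 -> U (y0 + t *: (y1 - y0))) -> a y1 - b y1 <= a y0 - b y0.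
Proof.
move=> segU; apply/ler_addgt0Pr => e e0; rewrite -lerBlDl; pose L := `|y1 - y0|.
have L0 : 0 <= L by exact: normr_ge0.
have e1 : 0 < e / 2 / (L + 1) by rewrite !divr_gt0//; lra.
have e2 : 0 < e / 4 by rewrite divr_gt0.
have [d1 d10 second_le] := @powR_enorm_second_difference R n p (2 * B) _ p1 e1.
have [d2 d20 unif] := compact_uniform_continuity (@closed_ball_compact R n (2 * B))
  (powR_enorm_continuous (lt_trans ltr01 p1)) e2.
have dm : 0 < Num.min d1 d2 / (L + 1) by rewrite divr_gt0 ?lt_min ?d10//; lra.
have [N] := ltr_add_invr dm; rewrite add0r ltr_pdivlMr; last lra.
set q := N.+1%:R^-1 => qL; have q0 : 0 < q by rewrite invr_gt0.
have qN : N.+1%:R * q = 1 by rewrite mulfV.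
have hE : `|q *: (y1 - y0)| = q * L by rewrite normrZ gtr0_norm.
have /andP[h_lt1 h_lt2] : (q * L < d1) && (q * L < d2).
  by rewrite -lt_min (le_lt_trans _ qL)// ler_pM2l//; lra.
have near_h z k : `|z| <= 2 * B -> `|k| < d2 -> `|enorm (z + k) `^ p - enorm z `^ p| <= e / 4.
  move=> zB kd; rewrite distrC; have := unif z (z + k) zB; rewrite -!ball_normE /ball_/=.
  by rewrite opprD addNKr normrN => /(_ kd)/ltW.
have := @subdivision_difference_le N y0 (q *: (y1 - y0)) (e / 2 / (L + 1) * (q * L)) (e / 4).
rewrite scalerA qN scale1r subrKC => /(_ _ _ _)/le_trans; apply.
- move=> j jN; rewrite scalerA; apply: segU; rewrite mulr_ge0 ?(ltW q0)//=.
  by rewrite -[leRHS]qN ler_pM2r// ler_nat.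
- by move=> z zB; rewrite -hE second_le// hE.
- by move=> z zB; split; apply: near_h => //; rewrite ?normrN hE.
have -> : N%:R * (e / 2 / (L + 1) * (q * L)) = e / 2 * ((N%:R * q) * (L / (L + 1))) by ring.
have Nq_le1 : N%:R * q <= 1 by rewrite -[leRHS]qN ler_pM2r// ler_nat.
have L_le1 : L / (L + 1) <= 1 by rewrite ler_pdivrMr; lra.
rewrite [leRHS](_ : e = e / 2 * 1 + 2 * (e / 4)); last by field.
rewrite lerD2r; apply: ler_wpM2l; first by rewrite divr_ge0// ltW.
by rewrite mulr_ile1// ?divr_ge0 ?mulr_ge0 ?(ltW q0)//; lra.
Qed.

Lemma common_supergradient_difference_cst : open U -> connected U ->
  forall y z, U y -> U z -> a y - b y = a z - b z.
Proof.
move=> oU cU; apply: connected_locally_constant => // y Uy.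
have /nbhs_ballP[r /= r0 ballU] := open_nbhs_nbhs (conj oU Uy).
apply/nbhs_ballP; exists r => // z yz.
have segU t : 0 <= t <= 1 -> U (y + t *: (z - y)).
  move=> /andP[t0 t1]; apply: ballU; move: yz; rewrite -!ball_normE /ball_/=.
  rewrite opprD addNKr normrN normrZ ger0_norm// distrC; apply: le_lt_trans.
  by rewrite ler_piMl.
apply: le_anti; rewrite !segment_difference_le// => t /andP[t0 t1].
have -> : z + t *: (y - z) = y + (1 - t) *: (z - y).
  by rewrite scalerBl scale1r addrA subrKC -opprB scalerN.
by apply: segU; rewrite subr_ge0 t1 gerBl.
Qed.

End SupergradientRigidity.

(** * Bounded domains of R^n *)

Section TupleSpace.
Context {R : realType} {n : nat}.
Implicit Types (x y : n.-tuple R) (z : 'rV[R]_n) (B e : R).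

Definition tuple_of_rv z : n.-tuple R := [tuple z ord0 i | i < n].

Lemma tuple_of_rvK : cancel tuple_of_rv rv.
Proof. by move=> z; apply/rowP => i; rewrite mxE tnth_mktuple. Qed.

Lemma rvK : cancel rv tuple_of_rv.
Proof. by move=> x; apply: eq_from_tnth => i; rewrite tnth_mktuple mxE. Qed.

Lemma rv_norm_leP x B : 0 <= B -> `|rv x| <= B <-> forall i, `|tnth x i| <= B.
Proof.
move=> B0; split=> [xB i|xB]; last by apply: mx_norm_le => // i; rewrite mxE.
by apply: le_trans xB; have := mx_norm_coord (rv x) i; rewrite mxE.
Qed.

Lemma rv_dist_leP x y B : 0 <= B -> `|rv x - rv y| <= B <-> forall i, `|tnth x i - tnth y i| <= B.
Proof.
move=> B0; split=> [xB i|xB]; last by apply: mx_norm_le => // i; rewrite !mxE.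
by apply: le_trans xB; have := mx_norm_coord (rv x - rv y) i; rewrite !mxE.
Qed.

Lemma tnth_preimage_measurable (i : 'I_n) (Y : set R) : measurable Y ->
  measurable [set x : n.-tuple R | Y (tnth x i)].
Proof. by move=> mY; have := @measurable_tnth _ R n i measurableT _ mY; rewrite setTI. Qed.

Lemma rv_closed_ball_measurable z B : 0 <= B -> measurable [set x | `|rv x - z| <= B].
Proof.
move=> B0; rewrite (_ : [set x | _] = \bigcap_(i in setT)
    [set x | `[z ord0 i - B, z ord0 i + B]%classic (tnth x i)]).
  by apply: fin_bigcap_measurable => // i _; exact: tnth_preimage_measurable.
apply/seteqP; split=> x /=; rewrite -[z]tuple_of_rvK rv_dist_leP// => xB i.
  by move=> _ /=; rewrite in_itv/= mxE -ler_distlC distrC; exact: xB.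
by have := xB i I; rewrite /= in_itv/= mxE -ler_distlC distrC.
Qed.

(* The cell of a point is recorded by comparing its coordinates with the levels [- B + j e]. *)
Lemma finite_grid B e : 0 < e -> exists (I : finType) (k : n.-tuple R -> I),
  measurable_fibers k /\
  forall x y, `|rv x| <= B -> `|rv y| <= B -> k x = k y -> `|rv x - rv y| <= e.
Proof.
move=> e0; pose K := (Num.truncn (2 * B / e)).+2.
pose k x := [ffun ij : 'I_n * 'I_K => tnth x ij.1 < - B + ij.2%:R * e].
exists {ffun 'I_n * 'I_K -> bool}, k; split.
  move=> s; rewrite (_ : _ @^-1` _ = \bigcap_(ij in [set: 'I_n * 'I_K])
      [set x : n.-tuple R | [set t : R | (t < - B + ij.2%:R * e) = s ij] (tnth x ij.1)]).
    apply: fin_bigcap_measurable => // ij _; apply: tnth_preimage_measurable.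
    set b := - B + _; case: (s ij).
      by rewrite (_ : [set t | _] = `]-oo, b[%classic)//;
        apply/seteqP; split=> t /=; rewrite in_itv.
    rewrite (_ : [set t | _] = `[b, +oo[%classic)//; apply/seteqP; split=> t /=.
      by rewrite in_itv/= andbT leNgt => ->.
    by rewrite in_itv/= andbT leNgt => /negbTE.
  apply/seteqP; split=> [x /= <- ij _|x /= x_s]; first by rewrite /= ffunE.
  by apply/ffunP => ij; rewrite ffunE; exact: x_s.
move=> x y xB yB kxy; have B0 : 0 <= B := le_trans (normr_ge0 _) xB.
apply/rv_dist_leP => [|i]; first exact: ltW.
suff coord_le x' y' : `|rv x'| <= B -> `|rv y'| <= B -> k x' = k y' ->
    tnth x' i - tnth y' i <= e by rewrite ler_norml coord_le// lerNl opprB coord_le.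
move=> /rv_norm_leP-/(_ B0 i) + /rv_norm_leP-/(_ B0 i) + kE.
rewrite !ler_norml leNgt => /andP[x1 x2] /andP[y1 y2]; apply/negP => xy.
have q0 : 0 <= (tnth y' i + B) / e by apply: divr_ge0; lra.
have /andP[t1 t2] := truncn_itv q0; set t := Num.truncn _ in t1 t2.
have tK : (t.+1 < K)%N.
  by rewrite ltnS /t; apply: le_truncn; rewrite ler_pM2r ?invr_gt0//; lra.
have := congr1 (fun s : {ffun _ -> bool} => s (i, Ordinal tK)) kE.
rewrite /= !ffunE /=; rewrite ltr_pdivrMr// in t2; rewrite ler_pdivlMr// in t1.
have -> : tnth y' i < - B + t.+1%:R * e by lra.
by apply/negP; rewrite -leNgt -natr1; nra.
Qed.

Lemma closed_bounded_measurable (F : set 'rV[R]_n) B : 0 <= B -> closed F ->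
  (forall z, F z -> `|z| <= B) -> measurable (rv @^-1` F).
Proof.
move=> B0 cF FB.
have /choice[A A_P] (m : nat) : exists A : set (n.-tuple R),
    [/\ measurable A, rv @^-1` F `<=` A &
     forall x, `|rv x| <= B -> A x -> exists2 y, F (rv y) & `|rv x - rv y| <= m.+1%:R^-1].
  have [|I [k [mk k_near]]] := @finite_grid B m.+1%:R^-1; first by rewrite invr_gt0.
  exists (\bigcup_(i in k @` (rv @^-1` F)) k @^-1` [set i]); split.
  - by apply: fin_bigcup_measurable; [exact: finite_finset|move=> i _].
  - by move=> x Fx; exists (k x) => //; exists x.
  - by move=> x xB [_ [y Fy <-]] /= kxy; exists y => //; apply: k_near => //; exact: FB.
rewrite (_ : _ @^-1` F = [set x | `|rv x - 0| <= B] `&` \bigcap_m A m).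
  apply: measurableI; first exact: rv_closed_ball_measurable.
  by apply: bigcapT_measurable => m; case: (A_P m).
apply/seteqP; split=> [x Fx|x [/=]].
  by split=> [|m _]; [rewrite /= subr0; exact: FB|have [_ + _] := A_P m; exact].
rewrite subr0 => xB xA; apply: cF => V /nbhs_ballP[r /= r0 ballV].
have [m] := ltr_add_invr r0; rewrite add0r => mr.
have [_ _ /(_ x xB (xA m I))[y Fy xy]] := A_P m; exists (rv y); split=> //.
by apply: ballV; rewrite -ball_normE /ball_/= (le_lt_trans xy).
Qed.

End TupleSpace.

Definition cost {R : realType} {n : nat} (p : R) (x y : n.-tuple R) : R := Defs.edist x y `^ p.

Lemma costE {R : realType} {n : nat} (p : R) (x y : n.-tuple R) :
  cost p x y = enorm (rv x - rv y) `^ p.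
Proof.
by rewrite /cost /Defs.edist /enorm; congr (Num.sqrt _ `^ _); apply: eq_bigr => i _; rewrite !mxE.
Qed.

Lemma lebesgue_closed_ball {R : realType} {n : nat} (leb : {measure set (n.-tuple R) -> \bar R})
  (z : 'rV[R]_n) (r : R) : is_lebesgue leb -> 0 <= r ->
  leb [set x | `|rv x - z| <= r] = ((2 * r) ^+ n)%:E.
Proof.
move=> Hleb r0; have lo_hi i : z ord0 i - r <= z ord0 i + r by lra.
have := Hleb (tuple_of_rv (z - const_mx r)) (tuple_of_rv (z + const_mx r)).
under [X in (_ -> _ = X%:E) -> _]eq_bigr => i _.
  rewrite (_ : _ - _ = 2 * r); last by rewrite !tnth_mktuple !mxE; ring.
  over.
rewrite prodr_const card_ord => <-; last by move=> i; rewrite !tnth_mktuple !mxE.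
congr (leb _); apply/seteqP; split=> x /=.
  rewrite -[z in `|_ - z|]tuple_of_rvK rv_dist_leP// => xz i.
  by have := xz i; rewrite !tnth_mktuple !mxE ler_distl.
move=> xz; rewrite -[z]tuple_of_rvK rv_dist_leP// => i.
by have := xz i; rewrite !tnth_mktuple !mxE ler_distl.
Qed.

Section BoundedDomain.
Context {R : realType} {n : nat} {leb : {measure set (n.-tuple R) -> \bar R}}.
Context {Om : set (n.-tuple R)} {p : R}.
Hypotheses (HOm : bounded_domain leb Om) (p1 : 1 < p).
Implicit Types (x y : n.-tuple R) (z : 'rV[R]_n).

Let rv_imageP x : (rv @` Om) (rv x) <-> Om x.
Proof. by split=> [[y Oy /(can_inj rvK) <-]|Ox] //; exists x. Qed.

Lemma domain_bounded : exists2 B : R, 0 <= B & forall x, Om x -> `|rv x| <= B.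
Proof.
have [[M [_ OmM]] _] := HOm; exists (`|M| + 1) => [|x Ox]; first by rewrite addr_ge0.
by apply: (OmM (`|M| + 1)); [rewrite ltr_pwDr// ler_norm|exists x].
Qed.

Lemma domain_core : exists U : set 'rV[R]_n,
  [/\ open U, connected U, U !=set0 & forall x, Om x <-> closure U (rv x)].
Proof.
have [_ [[U [oU [cU [U0 OmE]]]] _]] := HOm.
by exists U; split=> // x; rewrite -OmE rv_imageP.
Qed.

Lemma domain_measurable : measurable Om.
Proof.
have [B B0 OmB] := domain_bounded; have [U [_ _ _ OmU]] := domain_core.
rewrite (_ : Om = rv @^-1` closure U); last by apply/seteqP; split=> x /OmU.
apply: (closed_bounded_measurable B0); first exact: closed_closure.
by move=> z; rewrite -[z]tuple_of_rvK => /OmU/OmB.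
Qed.

Lemma cost_uniformly_continuous (e : R) : 0 < e -> exists2 d : R, 0 < d & forall x x' y,
  Om x -> Om x' -> Om y -> `|rv x - rv x'| < d -> `|cost p x y - cost p x' y| <= e.
Proof.
move=> e0; have [B _ OmB] := domain_bounded.
have [d d0 unif] := compact_uniform_continuity (@closed_ball_compact R n (2 * B))
  (powR_enorm_continuous (lt_trans ltr01 p1)) e0.
exists d => // x x' y Ox Ox' Oy xx'.
have xyB : `|rv x - rv y| <= 2 * B.
  by apply: le_trans (ler_normB _ _) _; have := OmB x Ox; have := OmB y Oy; lra.
have := unif (rv x - rv y) (rv x' - rv y) xyB; rewrite -!ball_normE /ball_/= -!costE.
by rewrite opprB addrA subrK => /(_ xx')/ltW.
Qed.

Lemma cost_measurable : measurable_fun setT (fun z : n.-tuple R * n.-tuple R => cost p z.1 z.2).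
Proof.
apply: (measurableT_comp (measurable_powR p)).
apply: (measurableT_comp (continuous_measurable_fun (@sqrt_continuous R))).
apply: measurable_sum => i; apply: measurable_funX; apply: measurable_funB.
  by apply: (measurableT_comp (measurable_tnth i)); exact: measurable_fst.
by apply: (measurableT_comp (measurable_tnth i)); exact: measurable_snd.
Qed.

Lemma domain_bounded_cost : bounded_cost Om (cost p).
Proof.
have [B _ OmB] := domain_bounded; have p0 : 0 < p := lt_trans ltr01 p1.
split=> [|x y||x y].
- have [U [_ _ [z Uz] OmU]] := domain_core; exists (tuple_of_rv z).
  by apply/OmU; rewrite tuple_of_rvK; exact: subset_closure.
- exact: powR_ge0.
- have /compact_bounded[M [_ cM]] :
      compact ((fun z : 'rV[R]_n => enorm z `^ p) @` [set z | `|z| <= 2 * B]).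
    apply: continuous_compact (@closed_ball_compact R n (2 * B)).
    exact/continuous_subspaceT/powR_enorm_continuous.
  exists (`|M| + 1) => x y Ox Oy; rewrite costE; apply: le_trans (ler_norm _) _.
  apply: cM; first by rewrite ltr_pwDr// ler_norm.
  exists (rv x - rv y) => //=; apply: le_trans (ler_normB _ _) _.
  by have := OmB x Ox; have := OmB y Oy; lra.
- by rewrite !costE -opprB enormN.
Qed.

Lemma cost_diag x : cost p x x = 0.
Proof.
rewrite costE subrr (_ : enorm 0 = 0) ?powR0 ?gt_eqF// ?(lt_trans ltr01 p1)//.
by rewrite /enorm big1 ?sqrtr0// => i _; rewrite mxE expr0n.
Qed.

Lemma domain_transport_space : transport_space Om (cost p).
Proof.
have [B _ OmB] := domain_bounded.
split; [exact: domain_bounded_cost|exact: domain_measurable|exact: cost_measurable|move=> e e0].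
have [d d0 cost_near] := cost_uniformly_continuous e0.
have d2 : 0 < d / 2 by rewrite divr_gt0.
have [I [k [mk k_near]]] := @finite_grid R n B _ d2.
have [x0 Ox0] := cost_domain_neq0 domain_bounded_cost.
have /choice[r r_k] i : exists r, Om r /\ ((exists2 x, Om x & k x = i) -> k r = i).
  have [[x Ox kx]|no_x] := pselect (exists2 x, Om x & k x = i); first by exists x.
  by exists x0; split.
exists I, k, r; split=> // [i|x y Ox Oy]; first by case: (r_k i).
have [Ork krk] := r_k (k x); apply: cost_near => //.
apply: (@le_lt_trans _ _ (d / 2)); last by lra.
by apply: k_near; [exact: OmB|exact: OmB|rewrite krk//; exists x].
Qed.

Section LebesgueMeasure.
Hypothesis Hleb : is_lebesgue leb.

Lemma lebesgue_domain_fin : (leb Om < +oo)%E.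
Proof.
have [B B0 OmB] := domain_bounded; apply: (@le_lt_trans _ _ (leb [set x | `|rv x - 0| <= B])).
  apply: le_measure; rewrite ?inE; [exact: domain_measurable|exact: rv_closed_ball_measurable|].
  by move=> x /OmB; rewrite /= subr0.
by rewrite lebesgue_closed_ball// ltry.
Qed.

Lemma domain_closed_ball y (d : R) : Om y -> 0 < d -> exists E : set (n.-tuple R),
  [/\ measurable E, (0 < leb E)%E, E `<=` Om & forall x, E x -> `|rv y - rv x| < d].
Proof.
have [U [oU _ _ OmU]] := domain_core => /OmU clU d0; have d2 : 0 < d / 2 by rewrite divr_gt0.
have [z [Uz]] := clU _ (nbhsx_ballx (rv y) _ d2); rewrite -ball_normE /ball_/= => yz.
have /nbhs_ballP[r /= r0 ballU] := open_nbhs_nbhs (conj oU Uz).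
pose s := Num.min (r / 2) (d / 2); have s0 : 0 < s by rewrite lt_min !divr_gt0.
exists [set x | `|rv x - z| <= s]; split.
- by apply: rv_closed_ball_measurable; exact: ltW.
- by rewrite lebesgue_closed_ball ?(ltW s0)// lte_fin exprn_gt0// mulr_gt0.
- move=> x /= xz; apply/OmU/subset_closure/ballU; rewrite -ball_normE /ball_/= distrC.
  by apply: le_lt_trans xz _; rewrite gt_min; apply/orP; left; lra.
- move=> x /= xz; rewrite -(subrKA z) (splitr d); apply: le_lt_trans (ler_normD _ _) _.
  by rewrite ltr_leD// distrC (le_trans xz)// ge_min lexx orbT.
Qed.

Lemma lebesgue_domain_gt0 : (0 < leb Om)%E.
Proof.
have [U [_ _ [z Uz] OmU]] := domain_core.
have Oz : Om (tuple_of_rv z) by apply/OmU; rewrite tuple_of_rvK; exact: subset_closure.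
have [E [mE E0 EOm _]] := domain_closed_ball Oz ltr01.
by apply: lt_le_trans E0 _; apply: le_measure; rewrite ?inE//; exact: domain_measurable.
Qed.

End LebesgueMeasure.
End BoundedDomain.

Section PotentialUniqueness.
Context {R : realType} {n : nat} {leb : {measure set (n.-tuple R) -> \bar R}}.
Context {Om : set (n.-tuple R)} {p : R}.
Hypotheses (Hleb : is_lebesgue leb) (HOm : bounded_domain leb Om) (p1 : 1 < p).
Implicit Types (x y : n.-tuple R) (z : 'rV[R]_n).
Local Notation ct := (ctransform Om (cost p)).

Let Hts : transport_space Om (cost p). Proof. exact: domain_transport_space HOm p1. Qed.

Lemma positive_density_charges (nu nus : {measure set (n.-tuple R) -> \bar R})
  (v : n.-tuple R -> R) :
  measurable_fun Om v -> {ae leb, forall x, Om x -> 0 < v x} ->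
  (forall A, measurable A -> nu A = (nus A + \int[leb]_(x in A `&` Om) (v x)%:E)%E) ->
  charges_cost_balls Om (cost p) nu.
Proof.
move=> mv v_gt0 nuE y e Oy e0.
have [d d0 cost_near] := cost_uniformly_continuous HOm p1 e0.
have [E [mE lebE EOm E_near]] := domain_closed_ball HOm Hleb Oy d0.
exists E; split=> // [|z Ez]; last first.
  by split=> [|x Ox]; [exact: EOm|apply: cost_near => //; [exact: EOm|exact: E_near]].
have mvE : measurable_fun E v by apply: measurable_funS EOm mv; exact: domain_measurable HOm.
have v_ae : {ae leb, forall x, E x -> 0 < v x} by apply: filterS v_gt0 => x vx /EOm/vx.
have v_int0 : (0 <= \int[leb]_(x in E) (v x)%:E)%E.
  suff -> : (\int[leb]_(x in E) (v x)%:E = \int[leb]_(x in E) `|v x|%:E)%E.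
    by apply: integral_ge0 => x _; rewrite lee_fin.
  apply: ae_eq_integral => //; first exact/measurable_EFinP.
    by apply/measurable_EFinP; exact: measurableT_comp.
  by apply: filterS v_ae => x vx /vx/ltW v0; rewrite ger0_norm.
rewrite lt_neqAle measure_ge0 andbT eq_sym; apply/eqP; rewrite nuE// (setIidl EOm) => nuE0.
move: lebE; rewrite (integral_gt0_null mE mvE v_ae) ?ltxx//.
by apply: le_anti; rewrite v_int0 andbT -nuE0 leeDr.
Qed.

Lemma dual_maximizer_unique (mu nu : probability (n.-tuple R) R) (phi psi : n.-tuple R -> R) :
  charges_cost_balls Om (cost p) nu ->
  dual_maximizer Om (cost p) mu nu phi -> dual_maximizer Om (cost p) mu nu psi ->
  exists l, forall x, Om x -> phi x = psi x - l.
Proof.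
move=> nu_charges phi_max psi_max; have [B _ OmB] := domain_bounded HOm.
have [U [oU cU [z0 Uz0] OmU]] := domain_core HOm.
have UOm z : U z -> Om (tuple_of_rv z).
  by move=> Uz; apply/OmU; rewrite tuple_of_rvK; exact: subset_closure.
have lct h : cconcave Om (cost p) h -> cost_lipschitz Om (cost p) (ct h).
  by move=> /(cconcave_lipschitz Hts)/(cost_lipschitz_bounded Hts)/(ctransform_lipschitz Hts).
have [[cphi _] [cpsi _]] := (phi_max, psi_max).
pose D x := ct phi x - ct psi x.
have D_U z : U z -> D (tuple_of_rv z) = D (tuple_of_rv z0).
  move=> Uz; apply: (@common_supergradient_difference_cst R n p B U
    (ct phi \o tuple_of_rv) (ct psi \o tuple_of_rv)) => // [y Uy|y s Uy s0].
    by rewrite -[y]tuple_of_rvK; apply: OmB; exact: UOm.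
  have [x Ox super] := dual_maximizers_supergradient Hts nu_charges phi_max psi_max (UOm y Uy) s0.
  exists (rv x); first exact: OmB.
  case: super => super_phi super_psi.
  split=> w; [have := super_phi (tuple_of_rv w)|have := super_psi (tuple_of_rv w)];
    by rewrite !costE !tuple_of_rvK.
have D_Om x : Om x -> D x = D (tuple_of_rv z0).
  move=> Ox; apply/eqP; rewrite -subr_eq0 -normr_le0; apply/ler_addgt0Pr => e e0; rewrite add0r.
  have e2 : 0 < e / 2 by rewrite divr_gt0.
  have [d d0 cost_near] := cost_uniformly_continuous HOm p1 e2.
  have [z [Uz]] := (OmU x).1 Ox _ (nbhsx_ballx (rv x) _ d0); rewrite -ball_normE /ball_/= => xz.
  have near_x y : Om y -> `|cost p x y - cost p (tuple_of_rv z) y| <= e / 2.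
    by move=> Oy; apply: cost_near => //; [exact: UOm|rewrite tuple_of_rvK].
  rewrite -(D_U z Uz) (splitr e).
  exact: cost_lipschitz_difference (lct _ cphi) (lct _ cpsi) Ox (UOm z Uz) near_x.
exists (D (tuple_of_rv z0)) => x Ox; rewrite -(cconcaveK Hts cphi Ox) -(cconcaveK Hts cpsi Ox).
apply: (ctransform_shift Hts) => [|y Oy]; first exact: (cost_lipschitz_bounded Hts (lct _ cpsi)).
by rewrite -(D_Om y Oy) /D subrKC.
Qed.

End PotentialUniqueness.

Section KantorovichFunctionals.
Context {R : realType} {n : nat} {leb : {measure set (n.-tuple R) -> \bar R}}.
Context {Om : set (n.-tuple R)}.
Hypothesis HOm : bounded_domain leb Om.
Implicit Types (mu nu : probability (n.-tuple R) R) (u psi : n.-tuple R -> R).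

Lemma kantorovich_potential_maximizer p mu nu psi : 1 < p ->
  kantorovich_potential p Om mu nu psi -> dual_maximizer Om (cost p) mu nu psi.
Proof.
move=> p1 [cpsi psi_max]; have Hts := domain_transport_space HOm p1.
have mO := domain_measurable HOm.
have kdualE h : cconcave Om (cost p) h ->
    kdual p Om mu nu h = (dual_value Om (cost p) mu nu h)%:E.
  move=> /(cconcave_lipschitz Hts) lh; have bh := cost_lipschitz_bounded Hts lh.
  have ih := cost_lipschitz_integrable Hts mu lh.
  have ict := cost_lipschitz_integrable Hts nu (ctransform_lipschitz Hts bh).
  rewrite /dual_value EFinD !fineK ?integrable_fin_num//.
  by congr (_ + _)%E; apply: eq_integral => y _; exact: (ctransform_EFin Hts).
apply: (cconcave_dual_maximizer Hts) => // h ch.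
by rewrite -lee_fin -!kdualE//; exact: psi_max.
Qed.

Lemma Fent_density f df mu u : convex_energy f df -> has_density leb Om mu u ->
  Fent f leb Om mu = internal_energy leb Om f u.
Proof.
move=> Hf hu; have mO := domain_measurable HOm.
have mu_fin : (mu Om < +oo)%E by apply: le_lt_trans (probability_le1 _ mO) (ltry _).
apply: le_anti; apply/andP; split; first by apply: ereal_inf_lbound; exists u.
apply: le_ereal_inf_tmp => _ [r hr <-]; rewrite le_eqVlt; apply/orP; left; apply/eqP.
have f_measurable (w : n.-tuple R -> R) : has_density leb Om mu w ->
    measurable_fun Om (fun x => (f (w x))%:E).
  move=> [mw [w0 _]]; apply/measurable_EFinP.
  exact: (nondecreasing_ge0_comp_measurable (energy_le Hf)).
apply: ae_eq_integral => //; try exact: f_measurable.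
by apply: filterS (has_density_unique mO mu_fin hu hr) => x ur Ox; rewrite ur.
Qed.

End KantorovichFunctionals.

Theorem theorem3p3 (R : realType) (n : nat)
  (leb : {measure set (n.-tuple R) -> \bar R}) (Hleb : is_lebesgue leb)
  (Om : set (n.-tuple R)) (HOm : bounded_domain leb Om)
  (p : R) (Hp : 1 < p)
  (f df k : R -> R)
  (Hf0 : f 0 = 0) (Hfpos : forall t : R, 0 <= t -> 0 <= f t)
  (Hfconv : forall x y l : R, 0 <= x -> 0 <= y -> x != y -> 0 < l < 1 ->
      f (l * x + (1 - l) * y) < l * f x + (1 - l) * f y)
  (Hdf : forall t : R, 0 < t -> is_derive t (1 : R) f (df t))
  (Hdf0 : (f h - f 0) / h @[h --> (0:R)^'+] --> df 0)
  (Hdfc : {within `[0, +oo[, continuous df})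
  (Hdf00 : df 0 = 0)
  (Hsuper : (fun t : R => f t / t) @ +oo --> +oo)
  (Hk : forall y : R, 0 <= y -> 0 <= k y /\ df (k y) = y)
  (nu : probability (n.-tuple R) R) (Hnu : in_P Om nu)
  (nus : {measure set (n.-tuple R) -> \bar R}) (v : n.-tuple R -> R)
  (Hnus : exists N, measurable N /\ leb N = 0%E /\ nus (~` N) = 0%E)
  (Hvm : measurable_fun Om v)
  (Hvinf : exists M : R, {ae leb, forall x, Om x -> `|v x| <= M})
  (Hvpos : {ae leb, forall x, Om x -> 0 < v x})
  (Hnudec : forall A, measurable A ->
      nu A = (nus A + \int[leb]_(x in A `&` Om) (v x)%:E)%E)
  (mu : probability (n.-tuple R) R) (u : n.-tuple R -> R)
  (Hmu : in_P Om mu) (Hu : is_density leb Om mu u)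
  (Hmin : forall mu' : probability (n.-tuple R) R, in_P Om mu' ->
      (Ffun p f leb Om nu mu <= Ffun p f leb Om nu mu')%E)
  (psi : n.-tuple R -> R) (Hpsi : kantorovich_potential p Om mu nu psi) :
  exists l : R,
    {ae leb, forall x, Om x -> 0 <= l - psi x} /\
    {ae leb, forall x, Om x -> u x = k (l - psi x)}.
Proof.
have Hts := domain_transport_space HOm Hp; have mO := domain_measurable HOm.
have Hf : convex_energy f df by split.
have mu_min (P : probability (n.-tuple R) R) r : has_density leb Om P r ->
    (transport_cost Om (cost p) mu nu + internal_energy leb Om f u <=
     transport_cost Om (cost p) P nu + internal_energy leb Om f r)%E.
  move=> hr; rewrite -(Fent_density HOm Hf hr) -(Fent_density HOm Hf Hu).
  exact/Hmin/(has_density_domain mO hr).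
have [phi [phi_max phi_le0 dfE]] := minimizer_potential Hts (lebesgue_domain_gt0 HOm Hleb)
  (lebesgue_domain_fin HOm Hleb) Hnu Hf (cost_diag Hp) Hu mu_min.
have nu_charges := positive_density_charges Hleb HOm Hp Hvm Hvpos Hnudec.
have [l phiE] := dual_maximizer_unique HOm Hp nu_charges phi_max
  (kantorovich_potential_maximizer HOm Hp Hpsi).
have l_ge x : Om x -> 0 <= l - psi x.
  by move=> Ox; rewrite -opprB -phiE// oppr_ge0 phi_le0.
exists l; split; first exact: aeW.
apply: filterS dfE => x /[swap] Ox /(_ Ox) dfE; have [k_ge0 dfk] := Hk _ (l_ge x Ox).
have [_ [u_ge0 _]] := Hu; apply: (energy_derive_inj Hf); rewrite ?nnegrE ?u_ge0//.
by rewrite dfE dfk phiE// opprB.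
Qed.
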